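(* Let $K$ be a knot in $S^3$ and let $D$ be a homogeneous diagram of $K$. Then the Rasmussen invariant of $K$ is $$s(K)=w(D)-O(D)+2\,O_{+}(D)-1.$$
   Context: Knots are oriented knots in $S^3$ and diagrams are planar knot diagrams. Diagram quantities: $w(D)$ is the writhe of $D$ (number of positive crossings minus number of negative crossings). $O(D)$ is the number of Seifert circles of $D$ (the circles obtained by smoothing every crossing along the orientation). $O_{+}(D)$ is the number of connected components (as a subset of the plane) of the diagram obtained from $D$ by smoothing, along the orientation, all negative crossings of $D$. Homogeneity: The Seifert graph $G(D)$ is the signed graph (each edge is labelled $+$ or $-$; multiple edges allowed) with one vertex for each Seifert circle of $D$ and one edge for each crossing of $D$, joining the two vertices corresponding to the two Seifert circles adjacent to the crossing, and labelled by the sign of the crossing. A block of a graph is a maximal connected subgraph having no cut-vertices (of its own). A signed graph is homogeneous if within each block all edges have the same sign. The diagram $D$ is homogeneous if $G(D)$ is homogeneous. Rasmussen invariant: Let $C^*_{Lee}(D)$ be Lee's complex over $\mathbb{Q}$: the cube-of-resolutions complex (with the $0$-smoothing of a positive crossing and the $1$-smoothing of a negative crossing being the oriented smoothings) built from $V=\mathbb{Q}\langle v_+,v_-\rangle$ with multiplication $v_+v_+=v_+$, $v_+v_-=v_-v_+=v_-$, $v_-v_-=v_+$ and comultiplication $v_+\mapsto v_+\otimes v_-+v_-\otimes v_+$, $v_-\mapsto v_-\otimes v_-+v_+\otimes v_+$. Let $n_\pm$ be the number of positive/negative crossings. A tensor product $v$ of basis vectors at a resolution with $k$ one-smoothings has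 homological degree $r=k-n_-$ and filtration grading $q(v)=\#\{v_+\}-\#\{v_-\}+r+n_+-n_-$; $q$ of a general nonzero element is the minimum of $q$ over the basis tensors occurring in it. The homology $H^*_{Lee}(K)$ is two-dimensional for a knot. For a nonzero class $[x]$ put $s([x])=\max\{q(y): [y]=[x]\}$. Then $s(K)=1+\min\{s([x]) : 0\ne[x]\in H^*_{Lee}(K)\}$; equivalently $s(K)=s([f_o])+1$, where $f_o$ is Lee's canonical cycle for the orientation $o$. With this normalization $s=2$ for the positive trefoil. *)

(* Defs.v *)
From HB Require Import structures.
From mathcomp Require Import all_boot all_order all_algebra.

Set Implicit Arguments.
Unset Strict Implicit.
Unset Printing Implicit Defensive.

Import Order.TTheory GRing.Theory Num.Theory.
Local Open Scope ring_scope.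

Definition is_min (P : int -> Prop) (m : int) : Prop :=
  P m /\ forall k, P k -> m <= k.

Definition is_max (P : int -> Prop) (m : int) : Prop :=
  P m /\ forall k, P k -> k <= m.

Lemma is_min_unique (P : int -> Prop) (m m' : int) :
  is_min P m -> is_min P m' -> m = m'.
Proof. by move=> [Pm le_m] [Pm' le_m']; apply: le_anti; rewrite le_m ?le_m'. Qed.

(* The classes of the equivalence relation generated by the pairs listed in
   g c, for c ranging over a finite type. *)
Definition glued (C T : finType) (g : C -> seq (T * T)) : {set {set T}} :=
  let e := fun x y : T =>
    [exists c, ((x, y) \in g c) || ((y, x) \in g c)] in
  equivalence_partition (connect e) [set: T].

(** Knot diagrams *)

(* A passage (c, b) is the over-strand (b = true) or the under-strand
   (b = false) of the crossing c; arc_in and arc_out give the arcs through which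
   the oriented knot enters and leaves it. *)
Record diagram_data := DiagramData {
  ncross : nat;
  narc : nat;
  arc_in : 'I_ncross * bool -> 'I_narc;
  arc_out : 'I_ncross * bool -> 'I_narc;
  positive : pred 'I_ncross
}.

Section Diagram.
Variable D : diagram_data.

Local Notation crossing := 'I_(ncross D).
Local Notation arc := 'I_(narc D).

Definition strands (c : crossing) : seq (arc * arc) :=
  [:: (arc_in (c, true), arc_out (c, true));
      (arc_in (c, false), arc_out (c, false))].

Definition oriented_smoothing (c : crossing) : seq (arc * arc) :=
  [:: (arc_in (c, true), arc_out (c, false));
      (arc_in (c, false), arc_out (c, true))].

Definition unoriented_smoothing (c : crossing) : seq (arc * arc) :=
  [:: (arc_in (c, true), arc_in (c, false));
      (arc_out (c, true), arc_out (c, false))].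

(* (a, true) and (a, false) are the left and right sides of the arc a.  Draw
   both strands of c upwards; the one going from bottom left to top right is
   the over-strand if and only if c is positive.  The four pairs are the
   bottom, right, top and left corners of c. *)
Definition corners (c : crossing) : seq ((arc * bool) * (arc * bool)) :=
  let p := (c, positive c) in
  let q := (c, ~~ positive c) in
  [:: ((arc_in p, false), (arc_in q, true));
      ((arc_in q, false), (arc_out p, false));
      ((arc_out p, true), (arc_out q, false));
      ((arc_out q, true), (arc_in p, true))].

(* The classes of arc sides glued along the corners are the faces.  With n
   crossings there are 2n edges, so a connected diagram lies on the sphere if
   and only if it has n + 2 faces.  The round circle is the case of no crossing
   and one arc: it has two faces. *)
Record is_knot_diagram : Prop := IsKnotDiagram {
  arc_in_inj : injective (@arc_in D);
  arc_out_inj : injective (@arc_out D);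
  arc_ends : codom (@arc_in D) =i codom (@arc_out D);
  one_component : #|glued strands| = 1%N;
  planar : #|glued corners| = (ncross D).+2
}.

Definition npos : nat := #|[set c | positive (d := D) c]|.
Definition nneg : nat := #|[set c | ~~ positive (d := D) c]|.

Definition writhe : int := npos%:Z - nneg%:Z.

Definition seifert_circles : {set {set arc}} := glued oriented_smoothing.

Definition nseifert : nat := #|seifert_circles|.

(* An unsmoothed crossing is a point joining its four arcs. *)
Definition smooth_negative (c : crossing) : seq (arc * arc) :=
  if positive c then (arc_in (c, true), arc_in (c, false)) :: strands c
  else oriented_smoothing c.

Definition nplus : nat := #|glued smooth_negative|.

(** Lee's complex *)

(* v_+ is encoded by true and v_- by false. *)
Definition lee_mul (x y : bool) : bool :=
  match x, y with
  | true, true => true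
  | true, false | false, true => false
  | false, false => true
  end.

Definition lee_comul (x : bool) : seq (bool * bool) :=
  if x then [:: (true, false); (false, true)]
  else [:: (false, false); (true, true)].

(* A vertex of the cube is the set S of the crossings that are 1-smoothed. *)
Definition smoothing (S : {set crossing}) (c : crossing) : seq (arc * arc) :=
  if positive c (+) (c \in S) then oriented_smoothing c
  else unoriented_smoothing c.

Definition circles (S : {set crossing}) : {set {set arc}} :=
  glued (smoothing S).

(* A tensor product of basis vectors is a vertex of the cube together with the
   set of the circles labelled v_+. *)
Definition enhanced_state : finType :=
  {v : {set crossing} * {set {set arc}} | v.2 \subset circles v.1}.

Definition ones (v : enhanced_state) : {set crossing} := (val v).1.
Definition plus_circles (v : enhanced_state) : {set {set arc}} := (val v).2.

Definition circle_of (v : enhanced_state) (a : arc) : {set arc} :=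
  pblock (circles (ones v)) a.

Definition label (v : enhanced_state) (a : arc) : bool :=
  circle_of v a \in plus_circles v.

Definition hdeg (v : enhanced_state) : int := #|ones v|%:Z - nneg%:Z.

Definition qdeg (v : enhanced_state) : int :=
  #|plus_circles v|%:Z - #|circles (ones v) :\: plus_circles v|%:Z
  + hdeg v + npos%:Z - nneg%:Z.

(* Whether the basis vector w occurs in the image of v under the multiplication
   or comultiplication at c.  In either smoothing of c, the incoming and the
   outgoing over-arc lie on different local strands, so a and b represent all
   the circles through c. *)
Definition edge_map (c : crossing) (v w : enhanced_state) : bool :=
  let a := arc_in (c, true) in
  let b := arc_out (c, true) in
  (plus_circles v :\: [set circle_of v a; circle_of v b]
     == plus_circles w :\: [set circle_of w a; circle_of w b])
  && (if circle_of v a == circle_of v b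
      then (label w a, label w b) \in lee_comul (label v a)
      else label w a == lee_mul (label v a) (label v b)).

Definition lee_coef (v w : enhanced_state) : rat :=
  \sum_(c | (c \notin ones v) && (ones w == c |: ones v))
    (-1) ^+ #|[set c' in ones v | (c' < c)%N]| * (edge_map c v w)%:R.

Definition lee_chain : zmodType := {ffun enhanced_state -> rat}.

Definition lee_d (x : lee_chain) : lee_chain :=
  [ffun w => \sum_v lee_coef v w * x v].

Definition lee_cycle (x : lee_chain) : Prop := lee_d x = 0.

Definition homologous (x y : lee_chain) : Prop :=
  exists z : lee_chain, y - x = lee_d z.

(** The Rasmussen invariant *)

Definition chain_q (x : lee_chain) (k : int) : Prop :=
  is_min (fun j => exists2 v, x v != 0 & qdeg v = j) k.

Definition class_s (x : lee_chain) (k : int) : Prop :=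
  is_max (fun j => exists2 y, homologous x y & chain_q y j) k.

Definition is_rasmussen (s : int) : Prop :=
  exists2 m, s = 1 + m &
    is_min (fun k => exists x,
      [/\ lee_cycle x, ~ homologous x 0 & class_s x k]) m.

Lemma is_rasmussen_unique (s s' : int) :
  is_rasmussen s -> is_rasmussen s' -> s = s'.
Proof.
by move=> [m -> min_m] [m' -> min_m']; rewrite (is_min_unique min_m min_m').
Qed.

End Diagram.

(** Homogeneous signed graphs *)

Record signed_graph := SignedGraph {
  vertex : finType;
  edge : finType;
  vertices : {set vertex};
  end1 : edge -> vertex;
  end2 : edge -> vertex;
  edge_sign : edge -> bool
}.

Section SignedGraph.
Variable G : signed_graph.

Definition subgraph : Type := ({set vertex G} * {set edge G})%type.

Definition is_subgraph (H : subgraph) : bool :=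
  (H.1 \subset vertices G)
  && [forall e in H.2, (end1 e \in H.1) && (end2 e \in H.1)].

Definition adjacent (H : subgraph) (x y : vertex G) : bool :=
  [exists e in H.2, ((end1 e == x) && (end2 e == y))
                    || ((end1 e == y) && (end2 e == x))].

Definition connected_graph (H : subgraph) : bool :=
  (H.1 != set0)
  && [forall x in H.1, forall y in H.1, connect (adjacent H) x y].

Definition remove_vertex (H : subgraph) (v : vertex G) : subgraph :=
  (H.1 :\ v, [set e in H.2 | (end1 e != v) && (end2 e != v)]).

Definition cut_vertex (H : subgraph) (v : vertex G) : bool :=
  (v \in H.1)
  && [exists x in H.1 :\ v, exists y in H.1 :\ v,
        connect (adjacent H) x y
        && ~~ connect (adjacent (remove_vertex H v)) x y].

Definition nonseparable (H : subgraph) : bool :=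
  [&& is_subgraph H, connected_graph H & [forall v, ~~ cut_vertex H v]].

Definition block (H : subgraph) : Prop :=
  nonseparable H /\
  forall H' : subgraph, nonseparable H' ->
    H.1 \subset H'.1 -> H.2 \subset H'.2 -> H' = H.

Definition homogeneous_graph : Prop :=
  forall H : subgraph, block H ->
    {in H.2 &, forall e e' : edge G, edge_sign e = edge_sign e'}.

End SignedGraph.

Definition seifert_graph (D : diagram_data) : signed_graph :=
  @SignedGraph {set 'I_(narc D)} 'I_(ncross D) (seifert_circles D)
    (fun c => pblock (seifert_circles D) (arc_in (c, true)))
    (fun c => pblock (seifert_circles D) (arc_in (c, false)))
    (@positive D).

Definition homogeneous (D : diagram_data) : Prop :=
  homogeneous_graph (seifert_graph D).

(* Main.v *)
(* In the basis of the eigenvectors v_- + v_+ and v_- - v_+ Lee's differential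
   preserves the label of every arc, so the complex splits over the labellings of
   the arcs.  A crossing whose arcs all carry the same label makes its summand
   acyclic; the labellings without such a crossing alternate along the knot, and
   the checkerboard colouring shows that the two of them live at the oriented
   smoothing.  Hence the homology is spanned by the two canonical cycles, and a
   class is determined by its two coefficients.

   Lower bound: at the oriented smoothing, cut a canonical cycle down to the
   states with an odd number of v_+ on each of the O_+ components of the diagram
   with the negative crossings smoothed (or an even number on exactly one of
   them).  The result is still a cycle, because toggling the two circles at a
   positive crossing changes the sign of a coefficient but not the parities.
   Such cycles represent every class and have filtration at least
   w - O + 2 O_+ - 2.

   Upper bound: dually, imposing an odd number of v_- on each of the O_-
   components of the diagram with the positive crossings smoothed gives a cocycle
   that detects a canonical cycle and is supported in degrees at most
   w + O - 2 O_-.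

   For a homogeneous diagram O + 1 <= O_+ + O_-, so the two bounds agree: deleting
   a vertex u of the Seifert graph leaves components that are each joined to u by
   edges of a single sign, hence the indicator function of u, and then every
   function on the vertices, is the sum over F_2 of a function constant along the
   positive edges and one constant along the negative edges. *)

Require Import Defs.
From mathcomp Require Import all_boot all_order all_algebra.
From mathcomp Require Import fingroup perm zify ring.

Set Implicit Arguments.
Unset Strict Implicit.
Unset Printing Implicit Defensive.

Import Order.TTheory GRing.Theory Num.Theory.
Local Open Scope ring_scope.

(** Doubling the sum pairs every term with its opposite, which also takes care of fixed points. Sums
    over states cancel in this way below, by toggling labels of circles. *)
Lemma sum_anti_involution (T : finType) (f : T -> T) (F : T -> rat) :
  involutive f -> (forall i, F (f i) = - F i) -> \sum_i F i = 0.
Proof.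
move=> fK Ff; set s := \sum_i F i.
suff: s + s = 0 by move/eqP; rewrite -mulr2n mulrn_eq0 => /eqP.
rewrite {1}/s (reindex_inj (inv_inj fK)) /= -big_split /=.
by rewrite big1 // => i _; rewrite Ff addNr.
Qed.

(** * Finite sets and gluings *)

Section SymmetricDifference.
Variable T : finType.
Implicit Types A B : {set T}.

Definition symd A B : {set T} := [set x | (x \in A) (+) (x \in B)].

Lemma in_symd A B x : (x \in symd A B) = (x \in A) (+) (x \in B).
Proof. by rewrite inE. Qed.

Lemma prod_symd (f : T -> rat) A B : (forall x, f x * f x = 1) ->
  \prod_(x in symd A B) f x = \prod_(x in A) f x * \prod_(x in B) f x.
Proof.
move=> f2; rewrite big_mkcond [X in _ = X * _]big_mkcond [X in _ = _ * X]big_mkcond /=.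
rewrite -big_split /=; apply: eq_bigr => x _; rewrite in_symd.
by case: (x \in A); case: (x \in B); rewrite /= ?mulr1 ?mul1r ?f2.
Qed.

Lemma setP2 (x y : T) A B : x != y ->
  (A == B) = [&& A :\: [set x; y] == B :\: [set x; y],
                 (x \in A) == (x \in B) & (y \in A) == (y \in B)].
Proof.
move=> nxy; apply/eqP/and3P => [->|[/eqP AB /eqP xAB /eqP yAB]]; first by rewrite !eqxx.
apply/setP => z; move/setP/(_ z): AB; rewrite !inE.
by have [->|_] := eqVneq z x; [|have [->|] := eqVneq z y].
Qed.

Lemma symdD A B : symd A B :\: B = A :\: B.
Proof. by apply/setP => x; rewrite !inE; case: (x \in B); rewrite ?addbF. Qed.

Lemma odd_card_symd A B : odd #|symd A B| = odd #|A| (+) odd #|B|.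
Proof.
have -> : symd A B = (A :\: B) :|: (B :\: A).
  by apply/setP => x; rewrite !inE; case: (x \in A); case: (x \in B).
rewrite cardsU (_ : _ :&: _ = set0) ?cards0 ?subn0; last first.
  by apply/setP => x; rewrite !inE; case: (x \in A); case: (x \in B).
rewrite oddD -(cardsID B A) -(cardsID A B) [B :&: A]setIC !oddD.
by case: (odd _); case: (odd _); case: (odd _).
Qed.

End SymmetricDifference.

Section Glued.
Variables (C T : finType).
Implicit Types g : C -> seq (T * T).

Definition glue_rel g : rel T := fun x y =>
  [exists c, ((x, y) \in g c) || ((y, x) \in g c)].

Local Notation same g := (connect (glue_rel g)).
Local Notation cls g := (pblock (glued g)).

Lemma same_sym g : connect_sym (glue_rel g).
Proof.
by apply: sym_connect_sym => x y; apply: eq_existsb => c; rewrite orbC.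
Qed.

Lemma same_trans g : transitive (same g).
Proof. exact: connect_trans. Qed.

Lemma same_pair g c x y : (x, y) \in g c -> same g x y.
Proof. by move=> xy; apply/connect1/existsP; exists c; rewrite xy. Qed.

Lemma same_ind (R : Type) (f : T -> R) g :
  (forall c x y, (x, y) \in g c -> f x = f y) -> forall x y, same g x y -> f x = f y.
Proof.
move=> gf x y /connectP[p]; elim: p x => [x _ -> //|z p IHp x] /= /andP[xz zp] lp.
rewrite -(IHp z) //; case/existsP: xz => c /orP[] /gf // ->.
Qed.

Lemma same_equiv g : {in [set: T] & &, equivalence_rel (same g)}.
Proof.
by move=> x y z _ _ _; split=> [|xy]; [exact: connect0 | exact: (same_connect (@same_sym g) xy)].
Qed.

Lemma glued_partition g : partition (glued g) [set: T].
Proof. exact: equivalence_partitionP (@same_equiv g). Qed.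

Lemma mem_cls g x y : (y \in cls g x) = same g x y.
Proof. exact: (pblock_equivalence_partition (@same_equiv g)). Qed.

Lemma cover_glued g x : x \in cover (glued g).
Proof. by rewrite (cover_partition (glued_partition g)). Qed.

Lemma cls_in g x : cls g x \in glued g.
Proof. by rewrite pblock_mem ?cover_glued. Qed.

Lemma glued_triv g : trivIset (glued g).
Proof. by have /and3P[] := glued_partition g. Qed.

Lemma glued_cls g A : A \in glued g -> exists x, A = cls g x.
Proof.
move=> gA; have /and3P[_ _ n0] := glued_partition g.
have [A0|[x Ax]] := set_0Vmem A; first by rewrite -A0 gA in n0.
by exists x; rewrite (def_pblock (glued_triv g) gA Ax).
Qed.

Lemma eq_cls g x y : (cls g x == cls g y) = same g x y.
Proof. by rewrite eq_pblock ?mem_cls ?cover_glued ?glued_triv. Qed.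

Lemma cls_eq g x y : same g x y -> cls g x = cls g y.
Proof. by move=> xy; apply/eqP; rewrite eq_cls. Qed.

Lemma glued_subset g g' x y :
  (forall c x y, (x, y) \in g c -> same g' x y) -> same g x y -> same g' x y.
Proof.
move=> gg' xy; rewrite -eq_cls; apply/eqP; move: x y xy; apply: same_ind.
by move=> c x y /gg'; apply: cls_eq.
Qed.

Lemma eq_glued g g' : g =1 g' -> glued g = glued g'.
Proof.
move=> gg'; have eq_same : same g =2 same g'.
  by apply: eq_connect => x y; apply: eq_existsb => c; rewrite gg'.
have cls_eq_cls x : cls g x = cls g' x by apply/setP => y; rewrite !mem_cls eq_same.
apply/setP => A; apply/idP/idP => /glued_cls[x ->].
  by rewrite cls_eq_cls cls_in.
by rewrite -cls_eq_cls cls_in.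
Qed.

Definition respects (R : eqType) g (f : T -> R) : bool :=
  [forall c, all (fun p => f p.1 == f p.2) (g c)].

Lemma respectsP (R : eqType) g (f : T -> R) :
  reflect (forall c x y, (x, y) \in g c -> f x = f y) (respects g f).
Proof.
apply: (iffP forallP) => [h c x y xy|h c].
  by move/allP/(_ _ xy)/eqP: (h c).
by apply/allP => -[x y] /h /= ->.
Qed.

Lemma respects_same (R : eqType) g (f : T -> R) x y :
  respects g f -> same g x y -> f x = f y.
Proof. by move/respectsP => gf; apply: same_ind gf x y. Qed.

Lemma same_respects (R : eqType) g (f : T -> R) :
  (forall x y, same g x y -> f x = f y) -> respects g f.
Proof. by move=> h; apply/respectsP => c x y /same_pair; apply: h. Qed.

(** A map constant on the classes amounts to a set of classes. Numbers of circles and components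
    thus become dimensions over F_2, which is how [homogeneous_count] compares them. *)
Lemma card_respects g :
  #|[set f : {ffun T -> bool} | respects g f]| = (2 ^ #|glued g|)%N.
Proof.
rewrite -card_powerset; apply: esym.
pose F (P : {set {set T}}) : {ffun T -> bool} := [ffun x => cls g x \in P].
have <- : F @: powerset (glued g) = [set f : {ffun T -> bool} | respects g f].
  apply/setP => f; rewrite inE; apply/imsetP/idP => [[P _ ->]|gf].
    by apply: same_respects => x y /cls_eq; rewrite !ffunE => ->.
  exists [set A in glued g | [exists x in A, f x]].
    by rewrite inE; apply/subsetP => A; rewrite inE => /andP[].
  apply/ffunP => x; rewrite ffunE inE cls_in /=; apply/idP/existsP => [fx|[y]].
    by exists x; rewrite mem_cls connect0.
  by rewrite mem_cls => /andP[/(respects_same gf) ->].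
rewrite card_in_imset // => P Q; rewrite !inE => /subsetP sP /subsetP sQ FPQ.
apply/setP => A; apply/idP/idP => AP.
  by have [x Ax] := glued_cls (sP _ AP); move/ffunP/(_ x): FPQ; rewrite !ffunE -Ax AP.
by have [x Ax] := glued_cls (sQ _ AP); move/ffunP/(_ x): FPQ; rewrite !ffunE -Ax AP.
Qed.

(** A class of [g] that avoids [a] and [b] contains no end of a pair at [c], so it is generated by
    pairs that [g'] shares. *)
Lemma glued_change_sub g g' c a b :
  (forall c', c' != c -> g c' = g' c') ->
  (forall x y, (x, y) \in g c ++ g' c ->
     (same g x a || same g x b) && (same g y a || same g y b)) ->
  glued g :\: [set cls g a; cls g b] \subset glued g' :\: [set cls g' a; cls g' b].
Proof.
move=> gg' ends; apply/subsetP => A; rewrite !inE negb_or => /andP[/andP[nAa nAb] gA].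
have [x Ax] := glued_cls gA; rewrite Ax !eq_cls in nAa nAb.
have off y : same g x y -> ~~ (same g y a || same g y b).
  by move=> xy; rewrite -!(same_connect (@same_sym g) xy) negb_or nAa.
have sub y : same g x y -> same g' x y.
  (* Following both relations along the chain at once keeps [off] available at every link. *)
  move=> xy; pose f y := same g x y && same g' x y.
  suff: f x = f y by rewrite /f !connect0 => /esym/andP[].
  apply: same_ind xy => c' {}y z yz; rewrite /f.
  rewrite -(same_connect_r (@same_sym g) (same_pair yz)).
  have [xy /=|//] := boolP (same g x y).
  have [c'c|c'c] := eqVneq c' c.
    have := ends y z; rewrite mem_cat -{1}c'c yz => /(_ isT)/andP[].
    by rewrite (negPf (off y xy)).
  by rewrite gg' // in yz; rewrite -(same_connect_r (@same_sym g') (same_pair yz)).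
have sub' y : same g' x y -> same g x y.
  move=> xy; suff: same g x x = same g x y by rewrite connect0.
  apply: same_ind xy => c' {}y z yz.
  have [c'c|c'c] := eqVneq c' c; last first.
    by rewrite -gg' // in yz; rewrite -(same_connect_r (@same_sym g) (same_pair yz)).
  have := ends y z; rewrite mem_cat -{2}c'c yz orbT => /(_ isT)/andP[ey ez].
  by apply/idP/idP => /off; rewrite ?ey ?ez.
have -> : A = cls g' x.
  by apply/setP => y; rewrite Ax !mem_cls; apply/idP/idP; [apply: sub | apply: sub'].
rewrite cls_in !eq_cls andbT negb_or.
by apply/andP; split; apply/negP => /sub' h; rewrite h in nAa nAb.
Qed.

Lemma glued_change g g' c a b :
  (forall c', c' != c -> g c' = g' c') ->
  (forall x y, (x, y) \in g c ++ g' c ->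
     (same g x a || same g x b) && (same g y a || same g y b)) ->
  (forall x y, (x, y) \in g c ++ g' c ->
     (same g' x a || same g' x b) && (same g' y a || same g' y b)) ->
  glued g :\: [set cls g a; cls g b] = glued g' :\: [set cls g' a; cls g' b].
Proof.
move=> gg' ends ends'; apply/eqP; rewrite eqEsubset !(@glued_change_sub _ _ c) //.
  by move=> c' /gg'.
by move=> x y; rewrite mem_cat orbC -mem_cat; apply: ends'.
Qed.

End Glued.

Notation same g := (connect (glue_rel g)).
Notation cls g := (pblock (glued g)).

(** Rank-nullity, with a kernel inside the line of constant vectors. For the boundary matrices
    below, connectedness then bounds the rank from below. *)
Lemma rank_constant_kernel (F : fieldType) (m n : nat) (A : 'M[F]_(m, n)) :
  (forall u : 'rV_m, u *m A = 0 -> exists k, u = const_mx k) ->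
  (m <= (\rank A).+1)%N.
Proof.
move=> h; have := mxrank_ker A; have := rank_leq_row A.
suff: (\rank (kermx A) <= 1)%N by lia.
apply: leq_trans (rank_leq_row (const_mx 1 : 'rV[F]_m)); apply: mxrankS.
apply/row_subP => i; have /h[k ->] : row i (kermx A) *m A = 0.
  by apply/sub_kermxP; rewrite row_sub.
suff -> : const_mx k = k *: const_mx 1 :> 'rV[F]_m by rewrite scalemx_sub.
by apply/rowP => j; rewrite !mxE mulr1.
Qed.

Lemma sum_delta (R : pzSemiRingType) (T : finType) (F : T -> R) x :
  \sum_y F y * (x == y)%:R = F x.
Proof.
rewrite (bigD1 x) //= eqxx mulr1 big1 ?addr0 // => y.
by rewrite eq_sym => /negPf ->; rewrite mulr0.
Qed.

Lemma F2_add_eq0 (x y : 'F_2) : (x + y == 0) = (x == y).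
Proof. by case: x => [[|[|?]] ?]; case: y => [[|[|?]] ?]. Qed.

Lemma F2_add_eq1 (x y : 'F_2) : (x + y == 1) = (x != y).
Proof. by case: x => [[|[|?]] ?]; case: y => [[|[|?]] ?]. Qed.

Lemma F2_neq (x y z : 'F_2) : x != y -> y != z -> x = z.
Proof. by case: x => [[|[|?]] ?]; case: y => [[|[|?]] ?]; case: z => [[|[|?]] ?] => // _ _; apply: val_inj. Qed.

Lemma F2_square (a b c d : 'F_2) : a + b + (b + c) + (d + c + (a + d)) = 0.
Proof.
by apply: val_inj; case: a b c d => [[|[|?]] ?] [[|[|?]] ?] [[|[|?]] ?] [[|[|?]] ?].
Qed.

Lemma sum_delta_in (T : finType) (A : {set T}) (F : T -> rat) x : x \in A ->
  \sum_(y in A) (y == x)%:R * F y = F x.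
Proof.
move=> Ax; rewrite (bigD1 x) //= eqxx mul1r big1 ?addr0 // => y /andP[_ /negPf ->].
by rewrite mul0r.
Qed.

Lemma setD1_eq (T : finType) (x : T) (A B : {set T}) :
  (A == B) = (A :\ x == B :\ x) && ((x \in A) == (x \in B)).
Proof.
apply/eqP/andP => [->|[/eqP AB /eqP xAB]]; first by rewrite !eqxx.
apply/setP => z; move/setP/(_ z): AB; rewrite !inE.
by have [->|_] := eqVneq z x.
Qed.

(** * Homogeneous graphs *)

Section Blocks.
Variable G : signed_graph.
Hypothesis ends_in : forall e : edge G, (end1 e \in vertices G) && (end2 e \in vertices G).

Definition whole : subgraph G := (vertices G, [set: edge G]).

Definition induced (A : {set vertex G}) : subgraph G :=
  (A, [set e | (end1 e \in A) && (end2 e \in A)]).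

Lemma adjacent_sym (H : subgraph G) : symmetric (adjacent H).
Proof. by move=> x y; apply: eq_existsb => e; rewrite orbC. Qed.

Lemma adjacent_induced (A : {set vertex G}) x y : x \in A -> y \in A ->
  adjacent whole x y -> adjacent (induced A) x y.
Proof.
move=> xA yA /existsP[e /andP[_ exy]]; apply/existsP; exists e; rewrite exy andbT inE.
by case/orP: exy => /andP[/eqP -> /eqP ->]; rewrite xA yA.
Qed.

Lemma adjacent_remove (H : subgraph G) v x y : x != v -> y != v ->
  adjacent H x y -> adjacent (remove_vertex H v) x y.
Proof.
move=> xv yv /existsP[e /andP[eH exy]]; apply/existsP; exists e; rewrite exy andbT inE eH.
by case/orP: exy => /andP[/eqP -> /eqP ->]; rewrite xv yv.
Qed.

Lemma adjacent_removeW (H : subgraph G) v x y : adjacent (remove_vertex H v) x y ->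
  [/\ adjacent H x y, x != v & y != v].
Proof.
move=> /existsP[e /andP[]]; rewrite inE => /andP[eH /andP[e1 e2]] exy.
split; first by apply/existsP; exists e; rewrite eH exy.
  by case/orP: exy => /andP[/eqP h1 /eqP h2]; [rewrite -h1 | rewrite -h2].
by case/orP: exy => /andP[/eqP h1 /eqP h2]; [rewrite -h2 | rewrite -h1].
Qed.

(** Rotating the cycle to start at the removed vertex leaves a path, which is connected. Length two
    is allowed, so that parallel edges are covered. *)
Lemma cycle_nonseparable (s : seq (vertex G)) : s != [::] -> uniq s ->
  path.cycle (adjacent whole) s -> nonseparable (induced [set x in s]).
Proof.
move=> s0 us cs; set A := [set x in s].
have rot_path v : v \in s -> exists s', [/\ s =i v :: s', uniq (v :: s') & path (adjacent whole) v (rcons s' v)].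
  case/rot_to => i s' rs; exists s'; split; last by rewrite -[path _ _ _]/(path.cycle _ (v :: s')) -rs rot_cycle.
    by move=> x; rewrite -rs mem_rot.
  by rewrite -rs rot_uniq.
have conn (e : rel (vertex G)) z p : (forall x y, x \in z :: p -> y \in z :: p -> adjacent whole x y -> e x y) ->
    path (adjacent whole) z p -> forall x, x \in z :: p -> connect e z x.
  move=> sub zp; apply: path_connect.
  by apply: (sub_in_path (P := [in z :: p])) zp; [move=> x y; apply: sub | apply/allP].
apply/and3P; split.
- apply/andP; split; last by apply/forall_inP => e; rewrite inE.
  apply/subsetP => v; rewrite inE => /rot_path[s' [_ _ /=]].
  have adj_in y : adjacent whole v y -> v \in vertices G.
    move=> /existsP[e /andP[_ evy]]; have /andP[e1 e2] := ends_in e.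
    by case/orP: evy => /andP[/eqP h1 /eqP h2]; [rewrite -h1 | rewrite -h2].
  by case: s' => [|y s'] /= /andP[/adj_in].
- apply/andP; split.
    by case: s s0 @A {us cs rot_path} => // x s _ A; apply/set0Pn; exists x; rewrite !inE eqxx.
  apply/forall_inP => x xA; apply/forall_inP => y yA.
  have := xA; rewrite inE => /rot_path[s' [ss' _]].
  rewrite rcons_path => /andP[xs' _]; apply: (conn _ _ _ _ xs'); last by rewrite -ss'; rewrite inE in yA.
  by move=> a b; rewrite -!ss' => aS bS; apply: adjacent_induced; rewrite inE.
- apply/forallP => v; apply/negP => /andP[vA /exists_inP[x xA /exists_inP[y yA /andP[_ /negP]]]]; apply.
  rewrite inE in vA; have [s' [ss' /= /andP[vs' _]]] := rot_path v vA.
  move: xA yA; rewrite /= !inE !ss' !inE => /andP[/negPf -> /=] xs' /andP[/negPf -> /=] ys'.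
  case: s' ss' vs' xs' ys' => // z s' ss' vs' xs' ys'.
  rewrite /= rcons_path => /and3P[_ zs' _].
  have zc a : a \in z :: s' -> connect (adjacent (remove_vertex (induced A) v)) z a.
    apply: conn zs' a => a b az bz ab; apply: adjacent_remove.
    - by apply: contraNneq vs' => <-.
    - by apply: contraNneq vs' => <-.
    - by apply: adjacent_induced => //; rewrite inE ss' inE ?az ?bz orbT.
  apply: connect_trans (zc y ys'); rewrite sym_connect_sym ?zc //; exact: adjacent_sym.
Qed.

Lemma nonseparable_in_block (H : subgraph G) : nonseparable H ->
  exists2 B, block B & H.2 \subset B.2.
Proof.
move=> nH; pose P (B : subgraph G) := [&& nonseparable B, H.1 \subset B.1 & H.2 \subset B.2].
have PH : P H by rewrite /P nH !subxx.
case: (arg_maxnP (fun B : subgraph G => #|B.1| + #|B.2|)%N PH) => B /and3P[nB H1 H2] Bmax.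
exists B => //; split=> // B' nB' s1 s2.
have := Bmax B'; rewrite /P nB' (subset_trans H1) // (subset_trans H2) // => /(_ isT) /= le.
have := subset_leq_card s1; have := subset_leq_card s2 => l2 l1.
have e1 : B.1 = B'.1 by apply/eqP; rewrite eqEcard s1 /=; lia.
have e2 : B.2 = B'.2 by apply/eqP; rewrite eqEcard s2 /=; lia.
by case: B B' e1 e2 {nB H1 H2 Bmax nB' s1 s2 le l1 l2} => ? ? [? ?] /= -> ->.
Qed.

Definition joins (e : edge G) x y :=
  ((end1 e == x) && (end2 e == y)) || ((end1 e == y) && (end2 e == x)).

(** A path from [y] to [y'] avoiding [v], made free of repetitions, closes up through [v] to a
    cycle. The subgraph induced on it lies in one block and contains both edges. *)
Lemma homogeneous_sign (v y y' : vertex G) (e e' : edge G) : homogeneous_graph G ->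
  joins e v y -> joins e' v y' -> y != v ->
  connect (adjacent (remove_vertex whole v)) y y' ->
  edge_sign e = edge_sign e'.
Proof.
move=> hG ej ej' yv /connectP[p0 p0P y'E].
case/shortenP: p0P y'E => p yp up _ y'E {p0}.
have vp : v \notin y :: p.
  rewrite inE eq_sym (negPf yv) /=; elim: p y yp {up y'E ej yv} => //= z p IH y /andP[yz zp].
  by rewrite inE negb_or (IH z) // andbT eq_sym; have [] := adjacent_removeW yz.
have adj : path (adjacent whole) v (y :: p).
  rewrite /=; apply/andP; split; first by apply/existsP; exists e; rewrite inE.
  by apply: sub_path yp => a b /adjacent_removeW[].
have cyc : path.cycle (adjacent whole) (v :: y :: p).
  rewrite /path.cycle rcons_path adj /= -y'E adjacent_sym.
  by apply/existsP; exists e'; rewrite inE.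
have [B blockB sB] : exists2 B, block B & (induced [set x in v :: y :: p]).2 \subset B.2.
  by apply/nonseparable_in_block/cycle_nonseparable => //; rewrite cons_uniq vp up.
apply: (hG B) => //; apply: (subsetP sB); rewrite !inE.
  by case/orP: ej => /andP[/eqP -> /eqP ->]; rewrite !eqxx ?orbT.
have y'p : y' \in y :: p by rewrite y'E mem_last.
by case/orP: ej' => /andP[/eqP -> /eqP ->]; rewrite -!in_cons !inE ?y'p ?eqxx ?orbT //;
   move: y'p; rewrite inE => ->; rewrite !orbT.
Qed.

End Blocks.

(** * Smoothings and the Fourier transform of Lee's complex *)

Section Diagram.
Variable D : diagram_data.

Local Notation crossing := 'I_(ncross D).
Local Notation arc := 'I_(narc D).
Local Notation io c := (arc_in (d := D) (c, true)).
Local Notation iu c := (arc_in (d := D) (c, false)).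
Local Notation oo c := (arc_out (d := D) (c, true)).
Local Notation ou c := (arc_out (d := D) (c, false)).
Local Notation face := (glued (@corners D)).
Local Notation os := (@oriented_smoothing D).
Local Notation sm := (smoothing (D := D)).
Local Notation state := (enhanced_state D).
Local Notation labelling := {ffun arc -> bool}.

Implicit Types (S R : {set crossing}) (c : crossing) (x y : arc) (v w : state).
Implicit Types (A B C X : {set arc}) (P Q : {set {set arc}}).
Implicit Types (f : labelling) (u : lee_chain D).

Definition oriented_at S c := positive c (+) (c \in S).

Lemma smoothing_off S c c' : c' != c -> sm S c' = sm (c |: S) c'.
Proof. by move=> c'c; rewrite /smoothing in_setU1 (negPf c'c). Qed.

Lemma oriented_atU S c : c \notin S -> oriented_at (c |: S) c = ~~ oriented_at S c.
Proof. by move=> cS; rewrite /oriented_at setU11 (negPf cS) addbT addbF. Qed.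

Lemma iu_same S c : same (sm S) (iu c) (if oriented_at S c then oo c else io c).
Proof.
have := @same_pair _ _ (sm S) c; rewrite /smoothing -/(oriented_at S c).
case: ifP => _ h; first by apply: h; rewrite !inE eqxx orbT.
by rewrite (same_sym _); apply: h; rewrite !inE eqxx.
Qed.

Lemma ou_same S c : same (sm S) (ou c) (if oriented_at S c then io c else oo c).
Proof.
have := @same_pair _ _ (sm S) c; rewrite /smoothing -/(oriented_at S c).
case: ifP => _ h; rewrite (same_sym _); apply: h; rewrite !inE eqxx //.
by rewrite orbT.
Qed.

Lemma strand_same S c : same (sm S) (iu c) (ou c) = same (sm S) (io c) (oo c).
Proof.
have := (iu_same S c, ou_same S c); case: ifP => _ [h1 h2];
  rewrite (same_connect (@same_sym _ _ _) h1) (same_connect_r (@same_sym _ _ _) h2) //.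
by rewrite (same_sym _).
Qed.

(** In either smoothing the four arc ends at [c] lie on the circles of its two over-arcs, so the
    remaining circles survive the change. *)
Lemma circles_change S c : c \notin S ->
  circles S :\: [set cls (sm S) (io c); cls (sm S) (oo c)] =
  circles (c |: S) :\: [set cls (sm (c |: S)) (io c); cls (sm (c |: S)) (oo c)].
Proof.
have ends S' x : x \in [:: io c; iu c; oo c; ou c] ->
    same (sm S') x (io c) || same (sm S') x (oo c).
  rewrite !inE => /or4P[] /eqP ->; rewrite ?connect0 ?orbT //.
    by have := iu_same S' c; case: ifP => _ ->; rewrite ?orbT.
  by have := ou_same S' c; case: ifP => _ ->; rewrite ?orbT.
have four x y : (x, y) \in sm S c ++ sm (c |: S) c ->
    (x \in [:: io c; iu c; oo c; ou c]) && (y \in [:: io c; iu c; oo c; ou c]).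
  rewrite mem_cat /smoothing; case: ifP => _; case: ifP => _;
  rewrite !inE !xpair_eqE => /orP[] /orP[] /andP[/eqP -> /eqP ->]; by rewrite !eqxx ?orbT.
move=> cS; apply: (@glued_change _ _ _ _ c) => [c' /smoothing_off //|x y|x y] /four/andP[hx hy].
  by rewrite !ends.
by rewrite !ends.
Qed.

(** The intersection makes the constructor total in [P]; it changes nothing when [P] consists of
    circles of [S]. *)
Definition state_of S P : state := Sub (S, P :&: circles S) (subsetIr _ _).

Lemma ones_state_of S P : ones (state_of S P) = S.
Proof. by []. Qed.

Lemma plus_state_of S P : plus_circles (state_of S P) = P :&: circles S.
Proof. by []. Qed.

Lemma plus_sub v : plus_circles v \subset circles (ones v).
Proof. exact: (valP v). Qed.

Lemma state_eq v w : ones v = ones w -> plus_circles v = plus_circles w -> v = w.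
Proof.
case: v w => [[S P] vP] [[S' Q] wQ]; rewrite /ones /plus_circles /= => e e'.
by apply: val_inj; rewrite /= e e'.
Qed.

Lemma state_ofK v : state_of (ones v) (plus_circles v) = v.
Proof. by apply: state_eq; rewrite ?plus_state_of ?(setIidPl (plus_sub v)). Qed.

Lemma sum_states S (F : state -> rat) :
  \sum_(v | ones v == S) F v = \sum_(P in powerset (circles S)) F (state_of S P).
Proof.
rewrite (reindex_onto (state_of S) (@plus_circles D)) /=.
  apply: eq_bigl => P; rewrite ones_state_of eqxx plus_state_of powersetE.
  exact: (sameP eqP setIidPl).
by move=> v /eqP <-; rewrite state_ofK.
Qed.

Definition toggle (T : {set {set arc}}) v := state_of (ones v) (symd (plus_circles v) T).

Lemma toggleK T : involutive (toggle T).
Proof.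
move=> v; apply: state_eq => //; apply/setP => C; rewrite !inE.
have /subsetP/(_ C) := plus_sub v.
rewrite ones_state_of; case: (C \in plus_circles v) => [/(_ isT) ->|_].
  by case: (C \in T).
by case: (C \in T); case: (C \in circles _).
Qed.

Lemma plus_toggle (T : {set {set arc}}) v : T \subset circles (ones v) ->
  plus_circles (toggle T v) = symd (plus_circles v) T.
Proof.
move=> sT; apply/setIidPl/subsetP => C; rewrite !inE.
have /subsetP/(_ C) := plus_sub v; have /subsetP/(_ C) := sT.
by case: (C \in T) => [/(_ isT) ->|_] // h; rewrite addbF; apply: h.
Qed.

(* Lee's complex splits in the basis of the tensor products of the eigenvectors
   v_- + v_+ and v_- - v_+.  Labelling the arcs of a circle true or false
   according to the factor used, chi f P is the coefficient, in the product
   labelled f, of the state whose set of circles v_+ is P. *)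
Definition circle_sign f (C : {set arc}) : rat := if C \subset [set x | f x] then 1 else -1.
Definition chi f P : rat := \prod_(C in P) circle_sign f C.

Lemma circle_sign2 f C : circle_sign f C * circle_sign f C = 1.
Proof. by rewrite /circle_sign; case: ifP; rewrite ?mulr1 ?mulrNN ?mulr1. Qed.

Lemma chi_symd f P Q : chi f (symd P Q) = chi f P * chi f Q.
Proof. by apply: prod_symd => C; apply: circle_sign2. Qed.

Lemma chi1 f C : chi f [set C] = circle_sign f C.
Proof. exact: big_set1. Qed.

Lemma chi2 f P : chi f P * chi f P = 1.
Proof.
by rewrite -chi_symd /chi big1 // => C; rewrite in_symd addbb.
Qed.

Lemma circle_sign_cls S f x : respects (sm S) f ->
  circle_sign f (cls (sm S) x) = (-1) ^+ ~~ f x.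
Proof.
move=> Sf; rewrite /circle_sign; case: ifPn => [/subsetP/(_ x)|h].
  by rewrite mem_cls connect0 inE => ->.
case E: (f x); last by rewrite expr1.
case/negP: h; apply/subsetP => y; rewrite mem_cls inE.
by move/(respects_same Sf) => <-.
Qed.

(** By orthogonality this is the coefficient of [u] on the eigenvector product labelled [f] at [S],
    times 2 to the number of circles. *)
Definition transform S f u : rat :=
  \sum_(v | ones v == S) chi f (plus_circles v) * u v.

(** The [chi f] are characters of the group of sets of circles under symmetric difference. If [f]
    and [f'] differ at [x], toggling the circle through [x] cancels the sum. *)
Lemma chi_orthogonal S f f' : respects (sm S) f -> respects (sm S) f' ->
  \sum_(P in powerset (circles S)) chi f P * chi f' P =
  (f == f')%:R * 2 ^+ #|circles S|.
Proof.
move=> Sf Sf'; have [<-|ff'] := eqVneq f f'.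
  rewrite mul1r (eq_bigr (fun=> 1)) => [|P _]; last exact: chi2.
  by rewrite sumr_const card_powerset natrX.
transitivity (\sum_(v | ones v == S) chi f (plus_circles v) * chi f' (plus_circles v)).
  rewrite sum_states; apply: eq_bigr => P; rewrite powersetE => SP.
  by rewrite plus_state_of (setIidPl SP).
rewrite mul0r big_mkcond /=.
have [x fx] : exists x, f x != f' x.
  by apply/existsP; apply: contraNT ff'; rewrite negb_exists => /forallP h; apply/eqP/ffunP => x; apply/eqP/negbNE/h.
apply: (sum_anti_involution (@toggleK [set cls (sm S) x])) => v.
rewrite ones_state_of; case: eqP => [vS|]; last by rewrite oppr0.
rewrite plus_toggle ?sub1set ?vS ?cls_in // !chi_symd !chi1 !circle_sign_cls //.
by move: fx; case: (f x) => //; case: (f' x) => // _; rewrite ?expr0 ?expr1; ring.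
Qed.

Definition flip (A : {set arc}) f : labelling := [ffun x => f x (+) (x \in A)].

Lemma flipK A : involutive (flip A).
Proof. by move=> f; apply/ffunP => x; rewrite !ffunE addbK. Qed.

Lemma respects_flip S A f : A \in circles S -> respects (sm S) (flip A f) = respects (sm S) f.
Proof.
move=> /glued_cls[x ->].
have step f1 : respects (sm S) f1 -> respects (sm S) (flip (cls (sm S) x) f1).
  move=> Sf1; apply: same_respects => y z yz; rewrite !ffunE !mem_cls (respects_same Sf1 yz).
  by rewrite (same_connect_r (@same_sym _ _ _) yz).
by apply/idP/idP => [/step|/step //]; rewrite flipK.
Qed.

Lemma chi_flip S A f P : A \in circles S -> P \subset circles S -> respects (sm S) f ->
  chi (flip A f) P = chi f P * (-1) ^+ (A \in P).
Proof.
move=> SA /subsetP SP Sf.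
have -> : (-1) ^+ (A \in P) = \prod_(C in P) (if C == A then -1 else 1) :> rat.
  case AP: (A \in P); last first.
    rewrite expr0 big1 // => C CP; case: eqP => // CA; by rewrite -CA CP in AP.
  by rewrite (big_setD1 A AP) /= eqxx big1 ?mulr1 // => C; rewrite !inE => /andP[/negPf ->].
rewrite -big_split /=; apply: eq_bigr => C /SP SC.
have [x Cx] := glued_cls SC; have [y Ay] := glued_cls SA.
rewrite Cx !(circle_sign_cls (S := S)) ?respects_flip // ffunE Ay eq_cls mem_cls (same_sym _ y).
by case: ifP => _; case: (f x); rewrite /= ?expr0 ?expr1; ring.
Qed.

(** The second orthogonality relation: now the label of a circle lying in exactly one of [P] and [Q]
    is flipped. *)
Lemma chi_dual_orthogonal S P Q : P \subset circles S -> Q \subset circles S ->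
  \sum_(f : labelling | respects (sm S) f) chi f P * chi f Q =
  (P == Q)%:R * 2 ^+ #|circles S|.
Proof.
move=> SP SQ; have [<-|PQ] := eqVneq P Q.
  rewrite mul1r (eq_bigr (fun=> 1)) => [|f _]; last exact: chi2.
  rewrite sumr_const -natrX -card_respects; congr (_ *+ _).
  by apply: eq_card => f; rewrite inE.
rewrite mul0r big_mkcond /=.
have [A PQA] : exists A, (A \in P) != (A \in Q).
  by apply/existsP; apply: contraNT PQ; rewrite negb_exists => /forallP h; apply/eqP/setP => A; apply/eqP/negbNE/h.
have SA : A \in circles S.
  move: PQA; have := subsetP SP A; have := subsetP SQ A.
  by case: (A \in P) => [_ /(_ isT)|] //; case: (A \in Q) => [/(_ isT)|].
apply: (sum_anti_involution (@flipK A)) => f.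
rewrite respects_flip //; case: ifP => [Sf|]; last by rewrite oppr0.
rewrite !(chi_flip SA) //; move: PQA.
by case: (A \in P) => //; case: (A \in Q) => // _; rewrite ?expr0 ?expr1; ring.
Qed.

Definition inverse_transform (W : {set crossing} -> labelling -> rat) : lee_chain D :=
  [ffun v => 2 ^- #|circles (ones v)|
     * \sum_(f : labelling | respects (sm (ones v)) f) W (ones v) f * chi f (plus_circles v)].

Lemma transformK (W : {set crossing} -> labelling -> rat) S f : respects (sm S) f ->
  transform S f (inverse_transform W) = W S f.
Proof.
move=> Sf; rewrite /transform sum_states.
under eq_bigr => P PS.
  rewrite ffunE plus_state_of ones_state_of (setIidPl _) -?powersetE // mulrCA mulr_sumr.
  over.
rewrite -mulr_sumr exchange_big /=.
under eq_bigr => f' Sf'.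
  under eq_bigr => P PS do rewrite mulrCA.
  rewrite -mulr_sumr chi_orthogonal //.
  over.
rewrite (bigD1 f) //= eqxx mul1r big1 => [|f' /andP[_ /negPf f'f]]; last first.
  by rewrite eq_sym f'f mul0r mulr0.
by rewrite addr0 mulrCA mulVf ?mulr1 // expf_neq0.
Qed.

Lemma transform_inj u :
  (forall S f, respects (sm S) f -> transform S f u = 0) -> u = 0.
Proof.
move=> u0; apply/ffunP => v; rewrite ffunE; pose S := ones v.
have : \sum_(f : labelling | respects (sm S) f) chi f (plus_circles v) * transform S f u = 0.
  by rewrite big1 // => f Sf; rewrite u0 ?mulr0.
under eq_bigr => f Sf do rewrite mulr_sumr.
rewrite exchange_big /=.
under eq_bigr => w wS.
  under eq_bigr => f Sf do rewrite mulrA.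
  have sw : plus_circles w \subset circles S by rewrite -(eqP wS) plus_sub.
  rewrite -mulr_suml chi_dual_orthogonal ?plus_sub //.
  over.
rewrite (bigD1 v) //= big1 => [|w /andP[/eqP wS wv]]; last first.
  case: eqP => [vw|]; last by rewrite !mul0r.
  by case/eqP: wv; apply: state_eq.
rewrite eqxx mul1r addr0 => /eqP; rewrite mulf_eq0 expf_eq0 andbF /=.
by move/eqP.
Qed.

Lemma transformB S f u u' : transform S f (u - u') = transform S f u - transform S f u'.
Proof.
by rewrite /transform -sumrB; apply: eq_bigr => v _; rewrite !ffunE mulrBr.
Qed.

(** The smoothing [S] already identifies the four labels at [c] in two couples, each containing one
    over-end. The other smoothing requires in addition that the two couples agree. *)
Lemma respects_change S S' c f :
  (forall c', c' != c -> sm S c' = sm S' c') ->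
  oriented_at S' c = ~~ oriented_at S c ->
  respects (sm S) f -> respects (sm S') f = (f (io c) == f (oo c)).
Proof.
move=> off orient Sf; move/respectsP: (Sf) => pairs.
have at_c S1 : respects (sm S1) f ->
    if oriented_at S1 c then f (io c) = f (ou c) /\ f (iu c) = f (oo c)
    else f (io c) = f (iu c) /\ f (oo c) = f (ou c).
  move/respectsP/(_ c); rewrite /smoothing -/(oriented_at S1 c).
  by case: ifP => _ h; split; apply: h; rewrite !inE eqxx ?orbT.
have at_S := at_c _ Sf; apply/idP/eqP => [/at_c|e].
  by rewrite orient; move: at_S; case: (oriented_at S c) => /= -[? ?] [? ?]; congruence.
apply/respectsP => c' x y; have [->|/off <-] := eqVneq c' c; last exact: pairs.
move: at_S; rewrite /smoothing -/(oriented_at S' c) orient.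
case: (oriented_at S c) => /= -[h1 h2]; rewrite !inE !xpair_eqE => /orP[] /andP[/eqP -> /eqP ->];
  congruence.
Qed.

Lemma respects_add S c f : c \notin S -> respects (sm S) f ->
  respects (sm (c |: S)) f = (f (io c) == f (oo c)).
Proof. by move=> cS; apply: respects_change; [move=> c'; apply: smoothing_off | apply: oriented_atU]. Qed.

Lemma respects_remove S c f : c \notin S -> respects (sm (c |: S)) f ->
  respects (sm S) f = (f (io c) == f (oo c)).
Proof.
move=> cS; apply: respects_change => [c' /smoothing_off //|].
by rewrite oriented_atU ?negbK.
Qed.

(** * Signs of the cube and monochromatic crossings *)

Definition cube_sign c S : rat := (-1) ^+ #|[set c' in S | (c' < c)%N]|.

Lemma cube_signU c c1 R : c1 \notin R ->
  cube_sign c (c1 |: R) = (-1) ^+ (c1 < c)%N * cube_sign c R.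
Proof.
move=> c1R; rewrite /cube_sign -exprD; congr (_ ^+ _).
rewrite (cardsD1 c1) !inE eqxx /=; congr (_ + _)%N; apply: eq_card => c'; rewrite !inE.
by have [->|] := eqVneq c' c1; first by rewrite (negPf c1R).
Qed.

Lemma cube_sign2 c S : cube_sign c S * cube_sign c S = 1.
Proof. by rewrite -expr2 sqrr_sign. Qed.

(** The squares of the cube anticommute, because exactly one of the two crossings precedes the
    other. *)
Lemma cube_sign_anti c c0 R : c != c0 -> c \notin R -> c0 \notin R ->
  cube_sign c R * cube_sign c0 R = - (cube_sign c0 (c |: R) * cube_sign c (c0 |: R)).
Proof.
move=> cc0 cR c0R; rewrite !cube_signU //.
have : (c < c0)%N (+) (c0 < c)%N.
  by have := cc0; rewrite -(inj_eq val_inj) /=; case: ltngtP.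
by case: (c < c0)%N; case: (c0 < c)%N => //= _; rewrite ?expr0 ?expr1; ring.
Qed.

(** For a labelling that respects some smoothing, this says that all four arcs at [c] have the same
    label, since each local strand contains one of these two ends. *)
Definition mono f c := f (io c) == f (oo c).

Definition mono_with f b : {set crossing} := [set c | mono f c && (f (io c) == b)].

Definition circles_with S f b : {set {set arc}} :=
  [set C in circles S | (C \subset [set x | f x]) == b].

Lemma cls_with S f x : respects (sm S) f -> (cls (sm S) x \subset [set y | f y]) = f x.
Proof.
move=> Sf; apply/subsetP/idP => [/(_ x)|fx y]; rewrite ?mem_cls inE; first by rewrite connect0 => ->.
by move/(respects_same Sf) => <-.
Qed.

(** The first summand counts circles away from [c], hence is the same at both ends of an edge of the
    cube. *)
Lemma card_circles_with S f b c : respects (sm S) f -> mono f c ->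
  let A := cls (sm S) (io c) in let B := cls (sm S) (oo c) in
  #|circles_with S f b| =
  (#|[set C in circles S :\: [set A; B] | (C \subset [set x | f x]) == b]|
   + (f (io c) == b) * (A != B).+1)%N.
Proof.
move=> Sf /eqP fc A B; rewrite -(cardsID [set A; B]) addnC; congr (_ + _)%N.
  by apply: eq_card => C; rewrite !inE andbA.
have AB_with C : C \in [set A; B] -> (C \in circles S) && ((C \subset [set x | f x]) == f (io c)).
  rewrite !inE /A /B => /orP[] /eqP ->; rewrite cls_in cls_with //=.
  by rewrite fc.
have [<-|fb] := eqVneq (f (io c)) b.
  rewrite mul1n -cards2; apply: eq_card => C; rewrite [LHS]in_setI [X in X && _]inE.
  by apply/andP/idP => [[]//|CAB]; split=> //; apply: AB_with.
rewrite mul0n; apply: eq_card0 => C; rewrite [LHS]in_setI [X in X && _]inE.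
apply/negbTE/negP => /andP[/andP[_ /eqP Cb] /AB_with /andP[_ /eqP Cc]].
by rewrite -Cb Cc eqxx in fb.
Qed.

(* Smoothing the crossings of sign b leaves one component per component of the
   subgraph of the Seifert graph formed by the edges of the other sign. *)
Definition smooth_sign (b : bool) c : seq (arc * arc) :=
  if positive c == b then os c else (io c, iu c) :: strands c.

Lemma respects_smooth_sign b f : respects os f ->
  (forall c, positive c != b -> f (io c) = f (iu c)) -> respects (smooth_sign b) f.
Proof.
move=> /respectsP osf fc; apply/respectsP => c x y; rewrite /smooth_sign.
case: eqP => [_|/eqP cb]; first exact: osf.
have h1 : f (io c) = f (arc_out (c, false)) by apply: (osf c); rewrite !inE eqxx.
have h2 : f (iu c) = f (arc_out (c, true)) by apply: (osf c); rewrite !inE eqxx orbT.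
rewrite !inE !xpair_eqE => /or3P[] /andP[/eqP -> /eqP ->]; rewrite -?h1 -?h2 ?fc //.
Qed.

Definition oriented_vertex : {set crossing} := [set c | ~~ positive c].

Local Notation So := oriented_vertex.

Lemma smoothing_oriented : sm So =1 @oriented_smoothing D.
Proof. by move=> c; rewrite /smoothing inE; case: (positive c). Qed.

Lemma circles_oriented : circles So = seifert_circles D.
Proof. exact: eq_glued smoothing_oriented. Qed.

Lemma nplusE : nplus D = #|glued (smooth_sign false)|.
Proof.
rewrite /nplus (eq_glued (g' := smooth_sign false)) // => c.
by rewrite /smooth_negative /smooth_sign eqbF_neg; case: (positive c).
Qed.

(** * Parity conditions on the components of a partly smoothed diagram *)

Section Parity.
Variable b : bool.
Local Notation comps := (glued (smooth_sign b)).
Implicit Types t : {set arc} -> bool.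

Definition within P X : {set {set arc}} := [set C in P | C \subset X].

Definition parity t P : bool := [forall X in comps, odd #|within P X| == t X].

Lemma same_oriented_comp x y : same (sm So) x y -> same (smooth_sign b) x y.
Proof.
apply: glued_subset => c {}x {}y; rewrite smoothing_oriented.
have pair p : p \in smooth_sign b c -> same (smooth_sign b) p.1 p.2.
  by case: p => x' y'; apply: same_pair.
rewrite /smooth_sign in pair *; case: ifP pair => _ pair.
  by move=> xy; apply: (pair (x, y)).
have h0 := pair (io c, iu c); have h1 := pair (io c, oo c); have h2 := pair (iu c, ou c).
rewrite /= !inE !eqxx ?orbT /= in h0 h1 h2.
rewrite !inE !xpair_eqE => /orP[] /andP[/eqP -> /eqP ->].
  exact: same_trans (h0 isT) (h2 isT).
by apply: same_trans (h1 isT); rewrite (same_sym _) h0.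
Qed.

Lemma circle_sub_comp x X : X \in comps -> (cls (sm So) x \subset X) = (x \in X).
Proof.
move=> /glued_cls[y ->]; rewrite mem_cls; apply/subsetP/idP => [/(_ x)|yx z].
  by rewrite !mem_cls connect0 => /(_ isT).
by rewrite !mem_cls => /same_oriented_comp; apply: same_trans.
Qed.

Definition comp_of C : {set arc} := odflt set0 [pick X in comps | C \subset X].

Lemma comp_ofP C X : C \in circles So -> X \in comps -> (comp_of C == X) = (C \subset X).
Proof.
move=> /glued_cls[x ->] gX; rewrite /comp_of; case: pickP => [Y /andP[gY]|/(_ X)]; last first.
  by rewrite gX /= => ->; apply/negbTE; have := glued_cls gX => -[y ->];
     rewrite eq_sym; apply/set0Pn; exists y; rewrite mem_cls connect0.
rewrite !circle_sub_comp // => xY /=; apply/eqP/idP => [<-//|xX].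
by rewrite -(def_pblock (glued_triv _) gY xY) (def_pblock (glued_triv _) gX xX).
Qed.

Lemma comp_of_in C : C \in circles So -> comp_of C \in comps.
Proof.
move=> SC; have [x Cx] := glued_cls SC; have gx := cls_in (smooth_sign b) x.
suff /eqP -> : comp_of C == cls (smooth_sign b) x by [].
by rewrite comp_ofP // Cx circle_sub_comp // mem_cls connect0.
Qed.

(** The two circles at an unsmoothed crossing lie in the same component, so each component sees both
    of them toggled or neither. *)
Lemma parity_toggle t P c (A := cls (sm So) (io c)) (B := cls (sm So) (oo c)) :
  positive c != b -> A != B -> parity t (symd P [set A; B]) = parity t P.
Proof.
move=> cb AB; apply: eq_forallb_in => X gX; congr (_ == _).
have -> : within (symd P [set A; B]) X = symd (within P X) (within [set A; B] X).
  by apply/setP => C; rewrite !inE; case: (C \subset X); rewrite ?andbT ?andbF.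
rewrite odd_card_symd [X in _ (+) X](_ : _ = false) ?addbF //.
have ABX : (A \subset X) = (B \subset X).
  rewrite !circle_sub_comp //; have [y ->] := glued_cls gX; rewrite !mem_cls.
  apply: (same_connect_r (@same_sym _ _ _)); apply: (same_pair (c := c)).
  by rewrite /smooth_sign (negPf cb) !inE eqxx orbT.
case AX: (A \subset X).
  have -> : within [set A; B] X = [set A; B].
    by apply/setP => C; rewrite !inE; case: eqP => [->|_]; [rewrite AX | case: eqP => // ->; rewrite -ABX].
  by rewrite cards2 AB.
have -> : within [set A; B] X = set0; last by rewrite cards0.
by apply/setP => C; rewrite !inE; case: eqP => [->|_]; [rewrite AX | case: eqP => // ->; rewrite -ABX].
Qed.

(** One circle is chosen in each component where [t] asks for an odd number. *)
Lemma parity_exists t : exists2 P : {set {set arc}}, P \subset circles So & parity t P.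
Proof.
pose rep X := if [pick x in X] is Some x then cls (sm So) x else set0.
have repP X : X \in comps -> rep X \in circles So /\ comp_of (rep X) = X.
  move=> gX; rewrite /rep; case: pickP => [x xX|X0]; last first.
    by have [y Xy] := glued_cls gX; have := X0 y; rewrite Xy mem_cls connect0.
  by rewrite cls_in; split=> //; apply/eqP; rewrite comp_ofP ?cls_in ?circle_sub_comp.
exists [set rep X | X in comps & t X].
  by apply/subsetP => C /imsetP[X]; rewrite inE => /andP[/repP[? _] _] ->.
apply/forall_inP => X gX; have [rX cX] := repP X gX.
rewrite (_ : within _ X = if t X then [set rep X] else set0).
  by case: (t X); rewrite ?cards1 ?cards0.
apply/setP => C; rewrite !inE; apply/andP/idP => [[/imsetP[Y]]|].
  rewrite inE => /andP[gY tY] ->; have [rY cY] := repP Y gY.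
  by rewrite -comp_ofP // cY => /eqP <-; rewrite tY inE.
case: ifP => [tX|]; rewrite ?inE // => /eqP ->; split; last by rewrite -comp_ofP // cX.
by apply/imsetP; exists X; rewrite ?inE ?gX.
Qed.

Lemma parity_card t (P : {set {set arc}}) : P \subset circles So -> parity t P ->
  (#|[set X in comps | t X]| <= #|P|)%N.
Proof.
move=> /subsetP SP /forall_inP tP; apply: leq_trans (leq_imset_card comp_of P).
apply/subset_leq_card/subsetP => X; rewrite inE => /andP[gX tX].
have := tP X gX; rewrite tX eqb_id => odd_X.
have /card_gt0P[C] : (0 < #|within P X|)%N by case: #|_| odd_X.
by rewrite inE => /andP[PC CX]; apply/imsetP; exists C; rewrite // (eqP (_ : comp_of C == X)) ?comp_ofP ?SP.
Qed.

(** Grouping circles by component makes the sign depend on [t] alone. This sign relates the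
    coefficients of a truncated cycle on the two canonical labellings. *)
Lemma parity_sign t (P : {set {set arc}}) : P \subset circles So -> parity t P ->
  (-1) ^+ #|P| = \prod_(X in comps) (-1) ^+ t X :> rat.
Proof.
move=> /subsetP SP /forall_inP tP; rewrite -prodr_const.
rewrite (partition_big comp_of (mem comps)) /= => [|C /SP /comp_of_in //].
apply: eq_bigr => X gX; rewrite -(eqP (tP X gX)) signr_odd -prodr_const.
apply: eq_bigl => C; rewrite inE; case PC: (C \in P) => //=.
by rewrite comp_ofP ?SP.
Qed.

End Parity.

(** The eigenvector product labelled [f] at the oriented vertex, truncated to the states allowed by
    [r]. *)
Definition parity_chain f (r : {set {set arc}} -> bool) : lee_chain D :=
  [ffun v => if (ones v == So) && r (plus_circles v) then chi f (plus_circles v) else 0].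

Local Notation comps b := (glued (smooth_sign b)).

Lemma lee_dB u u' : lee_d (u - u') = lee_d u - lee_d u'.
Proof.
apply/ffunP => w; rewrite !ffunE -sumrB; apply: eq_bigr => v _.
by rewrite !ffunE mulrBr.
Qed.

Definition lin_comb (a b : rat) u u' : lee_chain D := [ffun v => a * u v + b * u' v].

Lemma lee_d_lin_comb a b u u' : lee_d (lin_comb a b u u') = lin_comb a b (lee_d u) (lee_d u').
Proof.
apply/ffunP => w; rewrite !ffunE !mulr_sumr -big_split; apply: eq_bigr => v _ /=.
by rewrite ffunE; ring.
Qed.

Lemma transform_lin_comb S f a b u u' :
  transform S f (lin_comb a b u u') = a * transform S f u + b * transform S f u'.
Proof.
rewrite /transform !mulr_sumr -big_split; apply: eq_bigr => v _ /=.
by rewrite ffunE; ring.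
Qed.

Lemma card_oriented_vertex : #|So| = nneg D.
Proof. by []. Qed.

(** The homological degree is 0 here, the 1-smoothed crossings being the negative ones. *)
Lemma qdeg_oriented v : ones v = So ->
  qdeg v = writhe D - (nseifert D)%:Z + 2 * #|plus_circles v|%:Z.
Proof.
move=> vS; have sv := plus_sub v; rewrite vS in sv.
rewrite /qdeg /hdeg vS card_oriented_vertex /writhe cardsD (setIidPr sv).
have := subset_leq_card sv; rewrite circles_oriented.
rewrite -/(nseifert D); move: (nseifert D) => O; lia.
Qed.

(** * The checkerboard colouring *)

Hypothesis hK : is_knot_diagram D.

Lemma strands_constant (R : Type) (f : arc -> R) :
  (forall p, f (arc_in p) = f (arc_out p)) -> forall x y, f x = f y.
Proof.
move=> fp x y; apply: (@same_ind _ _ _ f (@strands D)).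
  by move=> c {}x {}y; rewrite !inE !xpair_eqE => /orP[] /andP[/eqP -> /eqP ->].
rewrite -eq_cls; apply/eqP; have /eqP/cards1P[A glA] := one_component hK.
have := cls_in (@strands D) x; have := cls_in (@strands D) y.
by rewrite glA !inE => /eqP -> /eqP ->.
Qed.

Lemma codom_arc_in (c : crossing) x : x \in codom (arc_in (d := D)).
Proof.
have <- : (arc_in (c, true) \in codom (arc_in (d := D))) = (x \in codom (arc_in (d := D))).
  by apply: (@strands_constant _ (fun x => x \in codom _)) => p; rewrite codom_f (arc_ends hK) codom_f.
exact: codom_f.
Qed.

Lemma narcE (c : crossing) : narc D = (ncross D).*2.
Proof.
have := card_codom (arc_in_inj hK); rewrite card_prod card_bool !card_ord muln2 => <-.
by rewrite -[LHS]card_ord; apply: eq_card => x; rewrite codom_arc_in.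
Qed.

(** Together with [arc_boundary], the cellular boundary matrices modulo 2 of the decomposition of
    the sphere by the diagram; chains are row vectors. *)
Definition face_boundary : 'M['F_2]_(#|face|, narc D) :=
  \matrix_(i, a) (((a, true) \in (enum_val i : {set _}))%:R + ((a, false) \in (enum_val i : {set _}))%:R).

Definition arc_boundary : 'M['F_2]_(narc D, ncross D) :=
  \matrix_(a, c) ((arc_in (c, true) == a)%:R + (arc_in (c, false) == a)%:R
    + ((arc_out (c, true) == a)%:R + (arc_out (c, false) == a)%:R)).

Lemma cls_mem_face (t : arc * bool) : cls (@corners D) t \in face.
Proof. exact: cls_in. Qed.

Definition face_of (t : arc * bool) := enum_rank_in (cls_mem_face t) (cls (@corners D) t).

Lemma face_of_corner c s t : (s, t) \in corners c -> face_of s = face_of t.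
Proof.
move=> /same_pair /cls_eq st; apply: enum_val_inj.
by rewrite !enum_rankK_in ?st ?cls_in.
Qed.

Lemma mem_face i t : (t \in (enum_val i : {set _})) = (face_of t == i).
Proof.
apply/idP/eqP => [ti|<-]; last first.
  by rewrite enum_rankK_in ?cls_in // mem_cls connect0.
apply: enum_val_inj; rewrite enum_rankK_in ?cls_in //.
by apply: (def_pblock (glued_triv _) _ ti); exact: enum_valP.
Qed.

Lemma face_of_surj i : exists t, face_of t = i.
Proof.
have [t tE] := glued_cls (enum_valP i); exists t; apply/eqP.
by rewrite -mem_face tE mem_cls connect0.
Qed.

Lemma mul_face_boundary (u : 'rV_#|face|) a :
  (u *m face_boundary) 0 a = u 0 (face_of (a, true)) + u 0 (face_of (a, false)).
Proof.
rewrite mxE -!(sum_delta (u 0)) -big_split /=; apply: eq_bigr => i _.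
by rewrite mxE mulrDr !mem_face.
Qed.

Lemma mul_arc_boundary (u : 'rV_(narc D)) c :
  (u *m arc_boundary) 0 c = u 0 (arc_in (c, true)) + u 0 (arc_in (c, false))
    + (u 0 (arc_out (c, true)) + u 0 (arc_out (c, false))).
Proof.
rewrite mxE -!(sum_delta (u 0)) -!big_split /=; apply: eq_bigr => a _.
by rewrite mxE !mulrDr.
Qed.

Lemma corner_values (R : Type) (f : 'I_#|face| -> R) c :
  let p := (c, positive c) in let q := (c, ~~ positive c) in
  [/\ f (face_of (arc_in p, false)) = f (face_of (arc_in q, true)),
      f (face_of (arc_in q, false)) = f (face_of (arc_out p, false)),
      f (face_of (arc_out p, true)) = f (face_of (arc_out q, false)) &
      f (face_of (arc_out q, true)) = f (face_of (arc_in p, true))].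
Proof.
by split; congr f; apply: (@face_of_corner c); rewrite !inE eqxx ?orbT.
Qed.

Lemma both_strands (R : nmodType) (f : crossing * bool -> R) c :
  f (c, true) + f (c, false) = f (c, positive c) + f (c, ~~ positive c).
Proof. by case: positive => //=; rewrite addrC. Qed.

(** Each of the four corners at a crossing is bordered by two arc sides, so its face is counted
    twice. *)
Lemma boundary_boundary : face_boundary *m arc_boundary = 0.
Proof.
apply/row_matrixP => i; rewrite row0 rowE mulmxA; apply/rowP => c.
rewrite mul_arc_boundary !mul_face_boundary [RHS]mxE.
set u := delta_mx _ _.
rewrite (both_strands (fun p => u 0 (face_of (arc_in p, true)) + u 0 (face_of (arc_in p, false)))).
rewrite (both_strands (fun p => u 0 (face_of (arc_out p, true)) + u 0 (face_of (arc_out p, false)))).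
have [-> -> -> ->] := corner_values (u 0) c.
by rewrite F2_square.
Qed.

(** A set of faces without boundary agrees on the two sides of every arc, and going through a
    crossing preserves this common value. *)
Lemma rank_face_boundary : (#|face| <= (\rank face_boundary).+1)%N.
Proof.
apply: rank_constant_kernel => u uD.
have side a : u 0 (face_of (a, true)) = u 0 (face_of (a, false)).
  by apply/eqP; rewrite -F2_add_eq0 -mul_face_boundary uD mxE.
have cst : forall x y, u 0 (face_of (x, true)) = u 0 (face_of (y, true)).
  apply: (@strands_constant _ (fun x => u 0 (face_of (x, true)))) => -[c b].
  have [] := corner_values (u 0) c; rewrite -?side /=.
  by case: b; case: (positive c) => /= ? ? ? ?; congruence.
have [i0 _|f0] := pickP (fun _ : 'I_#|face| => true); last first.
  by exists 0; apply/rowP => i; have := f0 i.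
exists (u 0 i0); apply/rowP => i; rewrite mxE.
have [[x b] <-] := face_of_surj i; have [[y b'] <-] := face_of_surj i0.
by case: b; case: b'; rewrite -?side.
Qed.

Lemma rank_arc_boundary : (ncross D <= (\rank arc_boundary).+1)%N.
Proof.
rewrite -mxrank_tr; apply: rank_constant_kernel => u uP.
have eq_cross p p' : arc_in p = arc_out p' -> u 0 p.1 = u 0 p'.1.
  move=> pp'; apply/eqP; rewrite -F2_add_eq0; apply/eqP.
  transitivity ((u *m arc_boundary^T) 0 (arc_in p)); last by rewrite uP mxE.
  rewrite mxE -(sum_delta (fun q : crossing * bool => u 0 q.1) p).
  rewrite -(sum_delta (fun q : crossing * bool => u 0 q.1) p').
  rewrite -!(pair_bigA _ (fun c b => u 0 c * (_ == (c, b))%:R)) -big_split /=.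
  apply: eq_bigr => c _; rewrite !big_bool /= !mxE !mulrDr.
  by rewrite {3 4}pp' !(inj_eq (arc_in_inj hK)) !(inj_eq (arc_out_inj hK)) ![(c, _) == _]eq_sym.
have [c0 _|n0] := pickP (fun _ : crossing => true); last first.
  by exists 0; apply/rowP => i; have := n0 i.
exists (u 0 c0); apply/rowP => c; rewrite mxE.
pose f x := u 0 (iinv (codom_arc_in c0 x)).1.
have f_in p : f (arc_in p) = u 0 p.1.
  by rewrite /f; congr (u 0 _.1); apply: (arc_in_inj hK); rewrite f_iinv.
rewrite -(f_in (c, true)) -(f_in (c0, true)); apply: strands_constant => p.
by rewrite f_in; apply/esym/eq_cross; rewrite f_iinv.
Qed.

(** Four arc ends meet at each crossing, so the sum of all arcs is a cycle modulo 2, hence the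
    boundary of a set of faces. That set is the colouring, since every arc has it on exactly one
    side. *)
Lemma checkerboard : exists l : arc -> bool,
  (forall p, l (arc_out p) = ~~ l (arc_in p)) /\
  (forall c, l (arc_in (c, false)) = ~~ l (arc_in (c, true))).
Proof.
have [c0 _|n0] := pickP (fun _ : crossing => true); last first.
  by exists xpredT; split=> [[c b]|c]; have := n0 c.
have : ((const_mx 1 : 'rV['F_2]_(narc D)) <= face_boundary)%MS.
  have sub : (face_boundary <= kermx arc_boundary)%MS by apply/sub_kermxP/boundary_boundary.
  (* With n crossings the face matrix has rank at least n + 1, and the kernel has dimension at most
     2n - (n - 1), so every cycle is a boundary. The n + 2 faces of planarity enter here. *)
  have /andP[_ ker_sub] : (face_boundary == kermx arc_boundary)%MS.
    rewrite -(mxrank_leqif_eq sub) eqn_leq mxrankS // mxrank_ker.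
    have := rank_face_boundary; have := rank_arc_boundary.
    by have := planar hK; have := narcE c0; lia.
  apply: submx_trans ker_sub; apply/sub_kermxP/rowP => c.
  by rewrite mul_arc_boundary !mxE; apply: val_inj.
case/submxP => u /rowP uD.
have side a : u 0 (face_of (a, true)) != u 0 (face_of (a, false)).
  by rewrite -F2_add_eq1 -mul_face_boundary -uD mxE.
have flip (x y z : 'F_2) : x != y -> y != z -> (x == 1) = (z == 1).
  by move=> xy /(F2_neq xy) ->.
have neg (x y : 'F_2) : x != y -> (x == 1) = ~~ (y == 1).
  by case: x => [[|[|?]] ?]; case: y => [[|[|?]] ?].
have crossing_values c : let p := (c, positive c) in let q := (c, ~~ positive c) in
    let l a := u 0 (face_of (a, true)) == 1 in
    [/\ l (arc_out p) = ~~ l (arc_in p), l (arc_out q) = ~~ l (arc_in q)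
      & l (arc_in q) = ~~ l (arc_in p)].
  move=> p q l; have [h1 h2 h3 h4] := corner_values (u 0) c.
  have l_q : l (arc_in q) = ~~ l (arc_in p) by rewrite /l -h1; apply: neg; rewrite eq_sym.
  split=> //; last by rewrite l_q negbK /l h4.
  rewrite -l_q /l; apply: (flip _ _ _ (side _)).
  by rewrite -h2 eq_sym.
exists (fun a => u 0 (face_of (a, true)) == 1); split=> [[c b]|c]; have [] := crossing_values c.
  by case: b; case: (positive c).
by case: (positive c) => //= _ _ ->; rewrite negbK.
Qed.

(** * Lee's differential and its homology *)

(* l is the two-colouring of the arcs given by the checkerboard colouring of the
   faces: an arc is coloured by the face on its left. *)
Variable l : arc -> bool.
Hypothesis l_alt : forall p, l (arc_out p) = ~~ l (arc_in p).
Hypothesis l_cross : forall c, l (iu c) = ~~ l (io c).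

Definition strand_end (b : bool) (p : crossing * bool) : arc :=
  if b then arc_in p else arc_out p.

Lemma l_strand_end b c s : l (strand_end b (c, s)) = l (io c) (+) b (+) s.
Proof.
by case: b; case: s; rewrite /= ?l_alt ?l_cross ?addbT ?addbF ?negbK.
Qed.

Lemma strand_endP x b c : exists p, x = strand_end b p.
Proof.
have xin := codom_arc_in c x; have := xin; rewrite (arc_ends hK) => xout.
by case: b; [exists (iinv xin) | exists (iinv xout)]; rewrite /= f_iinv.
Qed.

Lemma strand_end_inj b : injective (strand_end b).
Proof. by case: b; [exact: arc_in_inj | exact: arc_out_inj]. Qed.

(* Reversing the arcs where l is false gives every crossing two incoming and
   two outgoing arcs, and both smoothings respect these new directions. *)
Definition arrive (q : crossing * bool) := strand_end q.2 (q.1, l (io q.1)).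
Definition depart (q : crossing * bool) := strand_end q.2 (q.1, ~~ l (io q.1)).

Lemma l_arrive q : l (arrive q) = q.2.
Proof. by rewrite l_strand_end addbAC addbb. Qed.

Lemma l_depart q : l (depart q) = ~~ q.2.
Proof. by rewrite l_strand_end addbAC addbN addbb. Qed.

Lemma arrive_inj : injective arrive.
Proof.
move=> [c b] [c' b'] e; have := congr1 l e; rewrite !l_arrive /= => eb.
by move: e; rewrite /arrive /= eb => /strand_end_inj [->].
Qed.

Lemma depart_inj : injective depart.
Proof.
move=> [c b] [c' b'] e; have := congr1 l e; rewrite !l_depart /= => /negb_inj eb.
by move: e; rewrite /depart /= eb => /strand_end_inj [->].
Qed.

Lemma arrive_surj c x : exists q, x = arrive q.
Proof.
have [[c' s] xE] := strand_endP x (l x) c; exists (c', l x).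
have := congr1 l xE; rewrite l_strand_end /arrive /=.
by case: s xE; case: (l (io c')); case: (l x).
Qed.

Definition turn S (q : crossing * bool) := (q.1, q.2 (+) oriented_at S q.1).

Lemma turn_inj S : injective (turn S).
Proof. by move=> [c b] [c' b'] [-> /= /addIb ->]. Qed.

Lemma arrive_turn S q : same (sm S) (arrive q) (depart (turn S q)).
Proof.
case: q => c b; have := @same_pair _ _ (sm S) c; rewrite /turn /arrive /depart /=.
rewrite /smoothing -/(oriented_at S c).
case: (oriented_at S c) => h; case: b; case: (l (io c)) => /=;
  (try by apply: h; rewrite !inE !eqxx ?orbT);
  by rewrite (same_sym _); apply: h; rewrite !inE !eqxx ?orbT.
Qed.

Lemma turn_pair S c x y : (x, y) \in sm S c ->
  exists q, (x, y) = (arrive q, depart (turn S q)) \/ (y, x) = (arrive q, depart (turn S q)).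
Proof.
rewrite /smoothing -/(oriented_at S c) /arrive /depart /turn.
case E: (oriented_at S c); rewrite !inE !xpair_eqE => /orP[] /andP[/eqP -> /eqP ->].
- exists (c, l (io c)); rewrite /= E; case: (l (io c)); by [left|right].
- exists (c, ~~ l (io c)); rewrite /= E; case: (l (io c)); by [left|right].
- exists (c, true); rewrite /= E; case: (l (io c)); by [left|right].
- exists (c, false); rewrite /= E; case: (l (io c)); by [left|right].
Qed.

(** Every edge of the cube is a merging or a splitting: circles are orbits of a permutation, and an
    edge multiplies it by a transposition. *)
Lemma merge_xor_split S c : c \notin S ->
  same (sm S) (io c) (oo c) (+) same (sm (c |: S)) (io c) (oo c).
Proof.
move=> cS.
have [g arrK gK] : bijective arrive.
  apply: inj_card_bij; first exact: arrive_inj.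
  rewrite -(card_codom arrive_inj); apply/subset_leq_card/subsetP => x _.
  by have [q ->] := arrive_surj c x; apply: codom_f.
(* From the arriving end [q], go through its crossing and along the departing arc to the next
   arrival. *)
pose f S' q := g (depart (turn S' q)).
have f_inj S' : injective (f S').
  by move=> q q' /(can_inj gK) /depart_inj /turn_inj.
pose s S' := perm (f_inj S').
have sS' S' q q' : same (sm S') (arrive q) (arrive q') = (q' \in porbit (s S') q).
  apply/idP/idP => [qq'|/porbitP[i ->]].
    suff: porbit (s S') (g (arrive q)) = porbit (s S') (g (arrive q')).
      by rewrite !arrK => /eqP; rewrite eq_porbit_mem porbit_sym.
    have turn1 q1 : porbit (s S') (g (arrive q1)) = porbit (s S') (g (depart (turn S' q1))).
      by rewrite arrK -[LHS](porbit_perm _ 1) expg1 permE.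
    apply: (@same_ind _ _ _ (fun x => porbit (s S') (g x)) _ _ _ _ qq') => c' x y.
    by case/turn_pair => q1 [] [-> ->]; rewrite turn1.
  elim: i q => [|i IH] q; first by rewrite expg0 perm1 connect0.
  rewrite expgS permM; apply: (same_trans _ (IH _)).
  by rewrite permE /f gK arrive_turn.
(* Changing the smoothing at [c] exchanges the exits of its two arriving ends. *)
have sE : s (c |: S) = (tperm (c, true) (c, false) * s S)%g.
  apply/permP => -[c' b]; rewrite permM (permE (f_inj (c |: S))) (permE (f_inj S)) /f /turn; congr (g (depart _)).
  have [->|c'c] := eqVneq c' c.
    by rewrite oriented_atU //; case: b; rewrite ?tpermL ?tpermR /=; case: (oriented_at S c).
  rewrite tpermD ?xpair_eqE 1?eq_sym ?(negPf c'c) //=.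
  by rewrite /oriented_at in_setU1 (negPf c'c).
have sE' : s S = (tperm (c, true) (c, false) * s (c |: S))%g.
  by rewrite sE mulgA tperm2 mul1g.
have swap S' : same (sm S') (io c) (oo c) = ((c, false) \in porbit (s S') (c, true)).
  rewrite -sS' /arrive /=; case: (l (io c)) => //.
  by rewrite strand_same.
rewrite !swap ![(c, false) \in _]porbit_sym.
(* A transposition splits a common orbit or merges two orbits. The two orbit counts together exclude
   that the ends are joined in both smoothings or in neither. *)
have := porbits_mul_tperm (s S) (c, true) (c, false).
have := porbits_mul_tperm (s (c |: S)) (c, true) (c, false).
rewrite /= -sE -sE' xpair_eqE /= andbF /=.
case: (_ \in _); case: (_ \in _) => //=; lia.
Qed.

(* With a = v_- + v_+ and b = v_- - v_+ one has aa = 2a, bb = -2b, ab = 0, and the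
   comultiplication sends a to a (x) a and b to b (x) b.  Since chi is not
   normalised by the number of circles, the factors 2, -2 of a merging become
   1, -1 here and the factor 1 of a splitting becomes 2. *)
Definition weight S c f : rat :=
  if same (sm S) (io c) (oo c) then 2 else (-1) ^+ ~~ f (io c).

(** Circles away from [c] contribute the common factor [chi f P0]; only the tables of multiplication
    and comultiplication remain to be checked. *)
Lemma edge_transform v c f : let S := ones v in
  c \notin S -> respects (sm (c |: S)) f ->
  \sum_(Q in powerset (circles (c |: S)))
     (edge_map c v (state_of (c |: S) Q))%:R * chi f Q
  = if respects (sm S) f then weight S c f * chi f (plus_circles v) else 0.
Proof.
move=> S cS S'f; set S' := c |: S in S'f *.
set A := cls (sm S) (io c); set B := cls (sm S) (oo c).
set A' := cls (sm S') (io c); set B' := cls (sm S') (oo c).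
set P := plus_circles v; pose P0 := P :\: [set A; B].
have P0S' : P0 \subset circles S' :\: [set A'; B'].
  by rewrite -circles_change // setSD // plus_sub.
have [A'P0 B'P0] : A' \notin P0 /\ B' \notin P0.
  by split; apply/negP => /(subsetP P0S'); rewrite !inE eqxx ?orbT.
have {}P0S' : P0 \subset circles S' by apply: subset_trans P0S' (subsetDl _ _).
have A'S' : A' \in circles S' by apply: cls_in.
have B'S' : B' \in circles S' by apply: cls_in.
have edgeE Q : Q \in powerset (circles S') -> edge_map c v (state_of S' Q) =
    (P0 == Q :\: [set A'; B']) &&
    (if A == B then (A' \in Q, B' \in Q) \in lee_comul (A \in P)
     else (A' \in Q) == lee_mul (A \in P) (B \in P)).
  by rewrite powersetE => SQ; rewrite /edge_map /label /circle_of plus_state_of (setIidPl SQ).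
(* The guard [A != B] prevents a single circle through [c] from being counted twice. *)
have chiP : chi f P = (if A \in P then circle_sign f A else 1) *
    (if (B \in P) && (A != B) then circle_sign f B else 1) * chi f P0.
  have chiD Q C : chi f Q = (if C \in Q then circle_sign f C else 1) * chi f (Q :\ C).
    rewrite /chi; case: ifP => [/(big_setD1 C)->//|/negbT CQ].
    by rewrite mul1r (setDidPl _) // disjoint_sym disjoints1.
  rewrite /P0 -setDDl (chiD _ A) (chiD (P :\ A) B) mulrA in_setD1 andbC.
  by rewrite [B == A]eq_sym.
have := merge_xor_split cS.
rewrite -/S' -!eq_cls -/A -/B -/A' -/B' /weight -eq_cls -/A -/B.
rewrite (respects_remove cS S'f).
have sA' : circle_sign f A' = (-1) ^+ ~~ f (io c) by apply: circle_sign_cls.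
have sB' : circle_sign f B' = (-1) ^+ ~~ f (oo c) by apply: circle_sign_cls.
have chiU Q C : C \notin Q -> chi f (C |: Q) = circle_sign f C * chi f Q.
  by move=> CQ; rewrite /chi big_setU1.
have A'B'_f : A' = B' -> f (io c) = f (oo c).
  by move/eqP; rewrite eq_cls; apply: respects_same.
have hsA : respects (sm S) f -> circle_sign f A = (-1) ^+ ~~ f (io c) by apply: circle_sign_cls.
have hsB : respects (sm S) f -> circle_sign f B = (-1) ^+ ~~ f (oo c) by apply: circle_sign_cls.
clearbody A B A' B'.
case: (eqVneq A B) => [AB|nAB] /=; last first.
  move=> /eqP A'B'; have fio := A'B'_f A'B'.
  have Sf : respects (sm S) f by rewrite (respects_remove cS S'f) fio.
  have [sA sB] := (hsA Sf, hsB Sf).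
  (* Merging into the circle [A']: exactly one state occurs in the image. *)
  pose Q0 := if lee_mul (A \in P) (B \in P) then A' |: P0 else P0.
  have Q0S' : Q0 \in powerset (circles S').
    by rewrite powersetE /Q0; case: ifP => _ //; rewrite subUset sub1set A'S'.
  rewrite fio eqxx.
  transitivity (chi f Q0).
    rewrite -[RHS](sum_delta_in _ Q0S'); apply: eq_bigr => Q SQ; congr ((nat_of_bool _)%:R * _).
    rewrite edgeE // (negPf nAB) -A'B' setUid (setD1_eq A' Q Q0).
    have -> : Q0 :\ A' = P0.
      rewrite /Q0; case: ifP => _; first by rewrite setU1K.
      by apply/setDidPl; rewrite disjoint_sym disjoints1.
    have -> : A' \in Q0 = lee_mul (A \in P) (B \in P).
      by rewrite /Q0; case: ifP => _; rewrite ?setU11 ?(negPf A'P0).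
    by rewrite eq_sym.
  rewrite chiP nAB andbT /Q0 sA sB fio (fun_if (chi f)) chiU // sA' fio.
  move: (chi f P0) (sqrr_sign rat (~~ f (oo c))) => X.
  rewrite expr2; move: (_ ^+ _) => e e2.
  by case: (A \in P); case: (B \in P); rewrite /= ?mulr1 ?mul1r // !mulrA e2 mul1r.
move=> nA'B'.
(* Splitting: [X1] and [X2] are the two terms of the comultiplication. They cancel when [f] differs
   on the two new circles, that is, when [f] does not respect [S]. *)
pose X1 := if A \in P then A' |: P0 else P0.
pose X2 := if A \in P then B' |: P0 else A' |: (B' |: P0).
have memX1 : (A' \in X1 = (A \in P)) * (B' \in X1 = false).
  by rewrite /X1; case: ifP => _; rewrite ?in_setU1 ?eqxx ?[B' == _]eq_sym ?(negPf nA'B') ?(negPf A'P0) ?(negPf B'P0).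
have memX2 : (A' \in X2 = ~~ (A \in P)) * (B' \in X2 = true).
  by rewrite /X2; case: ifP => _; rewrite ?in_setU1 ?eqxx ?orbT ?(negPf nA'B') ?(negPf A'P0) ?(negPf B'P0).
have [DX1 DX2] : X1 :\: [set A'; B'] = P0 /\ X2 :\: [set A'; B'] = P0.
  have DP0 z : (z \notin [set A'; B']) && (z \in P0) = (z \in P0).
    rewrite in_set2 negb_or -andbA; have [->|_] := eqVneq z A'; first by rewrite (negPf A'P0).
    by have [->|_] := eqVneq z B'; first by rewrite (negPf B'P0).
  split; apply/setP => z; rewrite in_setD /X1 /X2; case: ifP => _; rewrite -[RHS]DP0 //;
  by rewrite ?in_setU1 in_set1; case: (z == A'); case: (z == B').
have X1S' : X1 \in powerset (circles S').
  by rewrite powersetE /X1; case: ifP => _ //; rewrite subUset sub1set A'S'.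
have X2S' : X2 \in powerset (circles S').
  by rewrite powersetE /X2; case: ifP => _; rewrite !subUset !sub1set ?A'S' ?B'S'.
transitivity (chi f X1 + chi f X2).
  rewrite -(sum_delta_in _ X1S') -(sum_delta_in _ X2S') -big_split /=; apply: eq_bigr => Q SQ.
  rewrite edgeE // AB eqxx -mulrDl -natrD -AB; congr (_%:R * _).
  rewrite (setP2 Q X1 nA'B') (setP2 Q X2 nA'B') !memX1 !memX2 DX1 DX2 ![Q :\: _ == P0]eq_sym.
  by case: (P0 == _); case: (A \in P); case: (A' \in Q); case: (B' \in Q).
rewrite chiP AB eqxx andbF mulr1 -AB /X1 /X2; case: ifP => AP.
  rewrite !chiU // sA' sB'; case: eqP => [fio|].
    by rewrite hsA ?(respects_remove cS S'f) ?fio //; ring.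
  by case: (f (io c)); case: (f (oo c)) => // _; rewrite /= ?expr0 ?expr1; ring.
rewrite !chiU ?in_setU1 ?(negPf nA'B') // sA' sB'; case: eqP => [->|].
  by rewrite mulrA -expr2 sqrr_sign !mul1r mulr_natl mulr2n.
by case: (f (io c)); case: (f (oo c)) => // _; rewrite /= ?expr0 ?expr1; ring.
Qed.

Lemma transform_d S' f u : respects (sm S') f ->
  transform S' f (lee_d u) =
  \sum_(c in S' | respects (sm (S' :\ c)) f)
     cube_sign c (S' :\ c) * weight (S' :\ c) c f * transform (S' :\ c) f u.
Proof.
move=> S'f; rewrite /transform.
under eq_bigr => w wS'.
  rewrite ffunE mulr_sumr.
  under eq_bigr => v _.
    rewrite (_ : lee_coef v w = \sum_(c | (c \notin ones v) && (S' == c |: ones v))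
       cube_sign c (ones v) * (edge_map c v w)%:R); last by rewrite /lee_coef (eqP wS').
    rewrite mulr_suml mulr_sumr.
    over.
  over.
rewrite exchange_big /=.
under eq_bigr => v _ do rewrite exchange_big /=.
rewrite (exchange_big_dep (mem S')) /=; last first.
  by move=> v c _ /andP[_ /eqP ->]; rewrite setU11.
rewrite [RHS]big_mkcondr /=; apply: eq_bigr => c cS'.
under eq_bigl => v.
  have -> : (c \notin ones v) && (S' == c |: ones v) = (ones v == S' :\ c).
    apply/andP/eqP => [[cv /eqP ->]|->]; first by rewrite setU1K.
    by rewrite setD11 setD1K.
  over.
rewrite mulr_sumr.
transitivity (\sum_(v | ones v == S' :\ c) cube_sign c (S' :\ c) * u v *
    (if respects (sm (S' :\ c)) f then weight (S' :\ c) c f * chi f (plus_circles v) else 0)).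
  apply: eq_bigr => v /eqP vT.
  have cv : c \notin ones v by rewrite vT setD11.
  have S'E : c |: ones v = S' by rewrite vT setD1K.
  rewrite -vT -edge_transform ?S'E // mulr_sumr sum_states; apply: eq_bigr => Q SQ.
  rewrite plus_state_of (setIidPl _) -?powersetE //; ring.
case: ifP => _; last by rewrite big1 // => v _; rewrite mulr0.
by apply: eq_bigr => v _; ring.
Qed.

(** * Rescaling and contracting the summands of the complex *)

Definition half_count S f b := (#|circles_with S f b| + #|S :&: mono_with f b|)./2.

(* Chosen so that the rescaled differential has all coefficients 1 or -1:
   half_count goes up by one at a splitting and is unchanged at a merging. *)
Definition scale S f : rat :=
  2 ^- half_count S f true
  * ((-1) ^+ #|S :&: mono_with f false| * (- 2) ^- half_count S f false).

Lemma scale_neq0 S f : scale S f != 0.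
Proof.
by rewrite !mulf_neq0 ?invr_neq0 ?expf_neq0 // oppr_eq0 ?oner_eq0.
Qed.

Lemma card_mono_add S f b c : c \notin S -> mono f c ->
  #|(c |: S) :&: mono_with f b| = (#|S :&: mono_with f b| + (f (io c) == b))%N.
Proof.
move=> cS fc; rewrite setIUl cardsU [_ :&: (S :&: _)]setIACA [[set c] :&: S]disjoint_setI0 ?disjoints1 //.
rewrite set0I cards0 subn0 addnC; congr (_ + _)%N.
case E: (f (io c) == b).
  by apply/eqP/cards1P; exists c; apply/setP => c'; rewrite !inE; have [->|//] := eqVneq c' c; rewrite fc E.
by apply: eq_card0 => c'; rewrite !inE; have [->|//] := eqVneq c' c; rewrite E andbF.
Qed.

(** For the label of [c], a splitting raises both counts by one, while a merging lowers the first
    and raises the second; their sum grows by two or by zero. *)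
Lemma half_count_add S f b c : c \notin S -> respects (sm S) f -> mono f c ->
  half_count (c |: S) f b =
  (half_count S f b + (f (io c) == b) && same (sm S) (io c) (oo c))%N.
Proof.
move=> cS Sf fc; have S'f : respects (sm (c |: S)) f by rewrite respects_add.
rewrite /half_count card_mono_add // !(card_circles_with _ _ fc) // -circles_change //.
rewrite !eq_cls; have := merge_xor_split cS.
move: (same (sm S) _ _) (same (sm (c |: S)) _ _) (f (io c) == b) #|_| #|_| => [] [] // [] n m _ /=;
  lia.
Qed.

Lemma scale_weight S f c : c \notin S -> respects (sm S) f -> mono f c ->
  scale (c |: S) f * weight S c f = scale S f.
Proof.
move=> cS Sf fc; rewrite /scale /weight !(half_count_add _ _ Sf fc) // card_mono_add //.
have expfVS (x : rat) n : x != 0 -> x ^- n = x ^- n.+1 * x.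
  by move=> x0; rewrite exprS invfM mulrAC mulVf ?mul1r.
case: (f (io c)); case: (same _ _ _) => /=; rewrite ?addn0 ?addn1 ?expr0 ?expr1 ?mulr1 //.
- by rewrite [in RHS](expfVS 2) // mulrAC.
- rewrite [in RHS](expfVS (- 2)) // exprS.
  move: (2 ^- _) ((- 1) ^+ _) ((- 2) ^- _) => x y z; ring.
- rewrite exprS; move: (2 ^- _) ((- 1) ^+ _) ((- 2) ^- _) => x y z; ring.
Qed.

Lemma respectsD1 S f c : c \in S -> respects (sm S) f -> respects (sm (S :\ c)) f = mono f c.
Proof. by move=> cS Sf; rewrite (respects_remove (c := c)) ?setD11 // setD1K. Qed.

Lemma scaled_d S f u : respects (sm S) f ->
  scale S f * transform S f (lee_d u) =
  \sum_(c in S | mono f c) cube_sign c (S :\ c) * (scale (S :\ c) f * transform (S :\ c) f u).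
Proof.
move=> Sf; rewrite transform_d // mulr_sumr.
apply: eq_big => [c|c /andP[cS Scf]].
  by case cS: (c \in S); rewrite //= respectsD1.
have fc : mono f c by rewrite -(respectsD1 cS).
have := scale_weight (S := S :\ c) (negbT (setD11 _ _)) Scf fc; rewrite setD1K // => <-; ring.
Qed.

(** Each summand with a monochromatic crossing is a signed cube with unit coefficients, contracted
    along one direction; the other summands vanish by hypothesis. *)
Lemma exact_off_alternating u : lee_cycle u ->
  (forall S f, respects (sm S) f -> (forall c, ~~ mono f c) -> transform S f u = 0) ->
  exists z, u = lee_d z.
Proof.
move=> du0 u_alt; pose U S f := scale S f * transform S f u.
have dU S f : respects (sm S) f ->
    \sum_(c in S | mono f c) cube_sign c (S :\ c) * U (S :\ c) f = 0.
  move=> Sf; rewrite -scaled_d // du0 /transform big1 ?mulr0 // => v _.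
  by rewrite ffunE mulr0.
(* The contracting direction depends on [f] only, so it is the same at all vertices of the
   summand. *)
pose Z S f := if [pick c | mono f c] is Some c then
  (if c \in S then 0 else cube_sign c S * U (c |: S) f) else 0.
exists (inverse_transform (fun S f => (scale S f)^-1 * Z S f)).
set z := inverse_transform _; apply/eqP; rewrite -subr_eq0; apply/eqP.
apply: transform_inj => S f Sf; rewrite transformB; apply/eqP; rewrite subr_eq0; apply/eqP.
apply: (mulfI (scale_neq0 S f)); rewrite scaled_d // -/(U S f).
transitivity (\sum_(c in S | mono f c) cube_sign c (S :\ c) * Z (S :\ c) f); last first.
  apply: eq_bigr => c /andP[cS fc]; rewrite transformK ?respectsD1 //.
  by rewrite mulVKf ?scale_neq0.
rewrite /Z; case: pickP => [c0 fc0|nomono]; last first.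
  rewrite big1 => [|c _]; last by rewrite mulr0.
  by rewrite /U u_alt ?mulr0 // => c; rewrite nomono.
have [c0S|c0S] := boolP (c0 \in S).
  rewrite (bigD1 c0) ?c0S //= setD11 setD1K // mulrA cube_sign2 mul1r big1 ?addr0 // => c /andP[_ cc0].
  by rewrite !inE eq_sym cc0 c0S mulr0.
(* Off [c0], the value at [S] is read off from the cycle condition at [c0 |: S], and anticommuting
   squares match the remaining terms. *)
have := dU (c0 |: S) f; rewrite respects_add // => /(_ fc0).
rewrite (bigD1 c0) ?setU11 //= setU1K // => /eqP; rewrite addr_eq0 => /eqP e.
rewrite -[LHS]mul1r -(cube_sign2 c0 S) -mulrA e -sumrN mulr_sumr.
apply: eq_big => [c|c /andP[/andP[]]].
  rewrite in_setU1; have [->|cc0] := eqVneq c c0; first by rewrite (negPf c0S) andbF.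
  by rewrite /= andbT.
rewrite in_setU1 => /orP[/eqP -> _ /eqP//|cS fc cc0].
rewrite in_setD1 eq_sym cc0 (negPf c0S) /=.
have -> : (c0 |: S) :\ c = c0 |: S :\ c.
  by apply/setP => c'; rewrite !inE; have [->|] := eqVneq c' c; rewrite ?(negPf cc0).
rewrite mulrA cube_sign_anti ?setD11 ?inE ?(negPf c0S) ?andbF // setD1K //; ring.
Qed.

(** * The canonical labellings and the lower bound *)

Definition lab : labelling := finfun l.
Definition colab : labelling := [ffun x => ~~ l x].

Lemma respects_lab : respects (sm So) lab.
Proof.
apply/respectsP => c x y; rewrite smoothing_oriented !inE !xpair_eqE !ffunE.
by case/orP => /andP[/eqP -> /eqP ->]; rewrite l_alt l_cross ?negbK.
Qed.

Lemma respects_colab : respects (sm So) colab.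
Proof.
apply: same_respects => x y /(respects_same respects_lab).
by rewrite !ffunE => ->.
Qed.

Local Notation Cin c := (pblock (circles So) (io c)).
Local Notation Cout c := (pblock (circles So) (oo c)).

Lemma crossing_circles c : Cin c != Cout c.
Proof.
rewrite eq_cls; apply/negP => /(respects_same respects_lab).
by rewrite !ffunE l_alt; case: (l _).
Qed.

Lemma chi_toggle c P : chi lab (symd P [set Cin c; Cout c]) = - chi lab P.
Proof.
rewrite chi_symd [chi lab [set _; _]](big_setU1 _ (idx := 1)) ?inE ?crossing_circles //= big_set1.
rewrite !(circle_sign_cls _ respects_lab) !ffunE l_alt negbK.
by case: (l _); rewrite /= ?expr0 ?expr1; ring.
Qed.

Lemma pair_sub c S : S = So -> [set Cin c; Cout c] \subset circles S.
Proof. by move=> ->; rewrite subUset !sub1set !cls_in. Qed.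

Lemma parity_chain_toggle c r v : (forall P, r (symd P [set Cin c; Cout c]) = r P) ->
  parity_chain lab r (toggle [set Cin c; Cout c] v) = - parity_chain lab r v.
Proof.
move=> rc; rewrite !ffunE ones_state_of; case: eqP => [vS|_] /=; last by rewrite oppr0.
rewrite plus_toggle ?pair_sub // rc chi_toggle.
by case: (r _); rewrite ?oppr0.
Qed.

(** Edges leaving the oriented vertex add positive crossings and merge two circles with opposite
    eigenvector labels. Toggling v_+ and v_- on both circles preserves their product and reverses
    the coefficient. *)
Lemma lee_cycle_parity_chain r :
  (forall c, positive c -> forall P, r (symd P [set Cin c; Cout c]) = r P) ->
  lee_cycle (parity_chain lab r).
Proof.
move=> rc; apply/ffunP => w; rewrite !ffunE; rewrite /lee_coef.
under eq_bigr => v _ do rewrite mulr_suml.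
rewrite (exchange_big_dep xpredT) //= big1 // => c _; rewrite big_mkcond /=.
apply: (sum_anti_involution (@toggleK [set Cin c; Cout c])) => v.
rewrite ones_state_of; case: ifP => [/andP[cv wv]|_]; last by rewrite oppr0.
have [vS|vS] := eqVneq (ones v) So; last first.
  by rewrite !ffunE ones_state_of (negPf vS) !mulr0 oppr0.
have pc : positive c by rewrite vS inE negbK in cv.
rewrite parity_chain_toggle ?mulrN; last exact: rc.
congr (- (_ * _%:R * _)).
rewrite /edge_map /label /circle_of ones_state_of plus_toggle ?pair_sub // vS symdD.
move: (Cin c) (Cout c) (crossing_circles c) => a b /negPf ->; rewrite !in_symd set21 set22 !addbT.
by case: (a \in _); case: (b \in _).
Qed.

Definition pairing (x y : lee_chain D) : rat := \sum_v x v * y v.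

(** The dual cancellation: edges entering the oriented vertex add negative crossings, and toggling
    both factors permutes the terms of each comultiplication. *)
Lemma pairing_lee_d r u :
  (forall c, ~~ positive c -> forall P, r (symd P [set Cin c; Cout c]) = r P) ->
  pairing (parity_chain lab r) (lee_d u) = 0.
Proof.
move=> rc; rewrite /pairing.
under eq_bigr => w _ do rewrite [lee_d u w]ffunE mulr_sumr.
rewrite exchange_big big1 //= => v _; rewrite /lee_coef.
under eq_bigr => w _ do rewrite mulr_suml mulr_sumr.
rewrite (exchange_big_dep xpredT) //= big1 // => c _; rewrite big_mkcond /=.
apply: (sum_anti_involution (@toggleK [set Cin c; Cout c])) => w.
rewrite ones_state_of; case: ifP => [/andP[cv /eqP wv]|_]; last by rewrite oppr0.
have [wS|wS] := eqVneq (ones w) So; last first.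
  by rewrite !ffunE ones_state_of (negPf wS) !mul0r oppr0.
have nc : ~~ positive c.
  have : c \in So by rewrite -wS wv setU11.
  by rewrite inE.
rewrite parity_chain_toggle ?mulNr; last exact: rc.
congr (- (_ * (_ * _%:R * _))).
(* The two circles are distinct at the target, so the edge is a splitting. *)
have := merge_xor_split cv.
rewrite /edge_map /label /circle_of ones_state_of plus_toggle ?pair_sub // -wv wS symdD.
rewrite -!eq_cls -!/(circles _); move: (Cin c) (Cout c) (crossing_circles c) => a b /negPf ->.
rewrite addbF => ->; rewrite !in_symd set21 set22 !addbT.
by case: (_ \in plus_circles v); case: (a \in _); case: (b \in _).
Qed.

(** Both [f] and [l] alternate along the knot, so they differ by a constant. The incoming labels at
    each crossing are then opposite, which only the oriented smoothing allows. *)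
Lemma alternating_labels S f : respects (sm S) f -> (forall c, ~~ mono f c) ->
  S = So /\ (f = lab \/ f = colab).
Proof.
move=> Sf fc.
have alt p : f (arc_out p) = ~~ f (arc_in p).
  have fc' c : f (oo c) = ~~ f (io c) by have := fc c; rewrite /mono; case: (f (io c)); case: (f _).
  case: p => c [] //.
  have := respects_same Sf (iu_same S c); have := respects_same Sf (ou_same S c).
  by case: ifP => _ -> ->; rewrite fc' ?negbK.
have cst : forall x y, f x (+) l x = f y (+) l y.
  by apply: (strands_constant (f := fun x => f x (+) l x)) => p; rewrite alt l_alt addNb addbN negbK.
have f_cross c : f (iu c) = ~~ f (io c).
  by have := cst (iu c) (io c); rewrite l_cross; case: (f (iu c)); case: (f (io c)); case: (l _).
split.
  apply/setP => c; rewrite inE.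
  have := respects_same Sf (iu_same S c); rewrite f_cross /oriented_at.
  by case: (positive c); case: (c \in S) => //=; case: (f _).
have [x _|none] := pickP (fun _ : arc => true); last first.
  by left; apply/ffunP => x; have := none x.
case fl: (f x (+) l x); [right | left]; apply/ffunP => y; rewrite ffunE;
  by have := cst x y; rewrite fl; case: (f y); case: (l y).
Qed.

Lemma exists_arc : exists x : arc, true.
Proof.
have /card_gt0P[A /glued_cls[x _]] : (0 < #|glued (@strands D)|)%N by rewrite (one_component hK).
by exists x.
Qed.

Definition count_sets r : rat :=
  #|[set P in powerset (circles So) | r P]|%:R.

Lemma count_parity_neq0 b t : count_sets (parity b t) != 0.
Proof.
rewrite pnatr_eq0 -lt0n; apply/card_gt0P.
by have [P sP tP] := parity_exists b t; exists P; rewrite !inE sP.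
Qed.

Lemma sum_parity_chain (F : state -> rat) r :
  \sum_v parity_chain lab r v * F v =
  \sum_(P in powerset (circles So) | r P) chi lab P * F (state_of So P).
Proof.
rewrite (bigID (fun v => ones v == So)) /= [X in _ + X]big1 => [|v /negPf vS]; last first.
  by rewrite ffunE vS mul0r.
rewrite addr0 sum_states big_mkcondr; apply: eq_bigr => P; rewrite powersetE => sP.
rewrite ffunE ones_state_of eqxx plus_state_of (setIidPl sP) /=.
by case: (r P); rewrite ?mul0r.
Qed.

Lemma transform_parity_chain f r :
  transform So f (parity_chain lab r) =
  \sum_(P in powerset (circles So) | r P) chi lab P * chi f P.
Proof.
transitivity (\sum_v parity_chain lab r v * (if ones v == So then chi f (plus_circles v) else 0)).
  rewrite /transform big_mkcond; apply: eq_bigr => v _.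
  by case: eqP => _; rewrite ?mulr0 // mulrC.
rewrite sum_parity_chain; apply: eq_bigr => P /andP[]; rewrite powersetE => sP _.
by rewrite ones_state_of eqxx plus_state_of (setIidPl sP).
Qed.

Lemma transform_lab r : transform So lab (parity_chain lab r) = count_sets r.
Proof.
rewrite transform_parity_chain (eq_bigr (fun=> 1)) => [|P _]; last exact: chi2.
rewrite sumr_const /count_sets; congr (_ *+ _).
by apply: eq_card => P; rewrite inE.
Qed.

Lemma pairing_parity_chain r : 
  pairing (parity_chain lab r) (parity_chain lab xpredT) = count_sets r.
Proof.
rewrite /pairing sum_parity_chain -transform_lab transform_parity_chain.
apply: eq_bigr => P /andP[]; rewrite powersetE => sP _.
by rewrite ffunE ones_state_of eqxx plus_state_of (setIidPl sP).
Qed.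

Lemma chi_colab P : P \subset circles So -> chi colab P = chi lab P * (-1) ^+ #|P|.
Proof.
move=> /subsetP sP; rewrite -prodr_const -big_split; apply: eq_bigr => C /sP /glued_cls[x ->] /=.
rewrite (circle_sign_cls _ respects_colab).
rewrite (circle_sign_cls _ respects_lab) !ffunE.
by case: (l x); rewrite /= ?expr0 ?expr1; ring.
Qed.

Lemma transform_colab b t :
  transform So colab (parity_chain lab (parity b t)) =
  (\prod_(X in comps b) (-1) ^+ t X) * count_sets (parity b t).
Proof.
rewrite -transform_lab !transform_parity_chain mulr_sumr; apply: eq_bigr => P /andP[].
by rewrite powersetE => sP tP; rewrite chi_colab // (parity_sign sP tP) mulrA mulrC.
Qed.

(** Making one component even reverses the relative sign of the two canonical coefficients, so [y1]
    and [y2] together realise every pair of coefficients. *)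
Lemma homologous_lower_bound u : lee_cycle u ->
  exists2 y, homologous u y &
    forall v, y v != 0 -> writhe D - (nseifert D)%:Z + 2 * (nplus D)%:Z - 2 <= qdeg v.
Proof.
move=> du0; have [x0 _] := exists_arc; pose X0 := cls (smooth_sign false) x0.
pose t1 (X : {set arc}) := true; pose t2 (X : {set arc}) := X != X0.
pose y1 := parity_chain lab (parity false t1).
pose y2 := parity_chain lab (parity false t2).
pose N1 := count_sets (parity false t1); pose N2 := count_sets (parity false t2).
have N1_neq0 : N1 != 0 := count_parity_neq0 _ _.
have N2_neq0 : N2 != 0 := count_parity_neq0 _ _.
pose e : rat := \prod_(X in comps false) (-1) ^+ t1 X.
have e2 : e * e = 1.
  by rewrite /e -big_split big1 // => X _ /=; rewrite expr1 mulrNN mulr1.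
have e_t2 : \prod_(X in comps false) (-1) ^+ t2 X = - e.
  rewrite /e !(bigD1 X0 (cls_in _ _)) /= /t2 eqxx expr0 expr1 mul1r mulN1r opprK.
  by apply: eq_bigr => X /andP[_ ->].
have cyc t : lee_cycle (parity_chain lab (parity false t)).
  apply: lee_cycle_parity_chain => c pc P.
  by apply: parity_toggle; rewrite ?pc // crossing_circles.
pose al := transform So lab u; pose be := transform So colab u.
(* The weights solve a N1 + b N2 = [al] and e (a N1 - b N2) = [be], using e e = 1. *)
pose y := lin_comb ((al + e * be) / (2 * N1)) ((al - e * be) / (2 * N2)) y1 y2.
have dy : lee_d y = 0.
  by rewrite lee_d_lin_comb !cyc; apply/ffunP => v; rewrite !ffunE !mulr0 addr0.
have y_lab : transform So lab y = al.
  rewrite transform_lin_comb !transform_lab -/N1 -/N2; field; by rewrite N1_neq0 N2_neq0.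
have y_colab : transform So colab y = be.
  rewrite transform_lin_comb !transform_colab e_t2 -/e -/N1 -/N2.
  transitivity (e * e * be); last by rewrite e2 mul1r.
  field; by rewrite N1_neq0 N2_neq0.
have [z uyz] : exists z, u - y = lee_d z.
  apply: exact_off_alternating => [|S f Sf fc].
    by rewrite /lee_cycle lee_dB du0 dy subr0.
  rewrite transformB; have [-> [] ->] := alternating_labels Sf fc.
    by rewrite y_lab subrr.
  by rewrite y_colab subrr.
exists y.
  exists (0 - z); rewrite lee_dB -uyz (_ : lee_d 0 = 0) ?sub0r ?opprB //.
  by apply/ffunP => v; rewrite !ffunE big1 // => w _; rewrite ffunE mulr0.
move=> v yv.
(* The successor accounts for the component [X0], which [t2] does not force to contain a v_+; hence
   the final - 2. *)
have [vS [t tP tc]] : ones v = So /\ exists2 t, parity false t (plus_circles v) &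
    (nplus D <= #|[set X in comps false | t X]|.+1)%N.
  have : (y1 v != 0) || (y2 v != 0).
    by apply: contraNT yv; rewrite negb_or !negbK => /andP[/eqP y1v /eqP y2v];
       rewrite ffunE y1v y2v !mulr0 addr0.
  rewrite nplusE /y1 /y2 !ffunE; case: (ones v =P So) => [vS|_] //=.
  move=> h; split=> //; case/orP: h; case: ifP => // tP _.
    exists t1 => //; apply: leqW; apply: subset_leq_card; apply/subsetP => X gX.
    by rewrite inE gX.
  exists t2 => //; rewrite (cardsD1 X0) cls_in add1n ltnS; apply: subset_leq_card.
  by apply/subsetP => X; rewrite !inE andbC.
have sv := plus_sub v; rewrite vS in sv; have le_t := parity_card sv tP.
rewrite qdeg_oriented //; lia.
Qed.

(** * Homogeneity and the upper bound *)

Hypothesis hD : homogeneous D.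

Definition decomposable f :=
  exists g h, [/\ respects (smooth_sign false) g, respects (smooth_sign true) h
    & forall x, f x = g x (+) h x].

Lemma decomposable_circle (A : {set arc}) : A \in seifert_circles D ->
  decomposable [ffun x => x \in A].
Proof.
move=> SA; pose G := seifert_graph D.
have ends_in : forall e : edge G, (end1 e \in vertices G) && (end2 e \in vertices G).
  by move=> c; rewrite /= !cls_in.
pose conn := connect (adjacent (remove_vertex (whole G) A)).
(* [inX] marks the components of the Seifert graph without [A] that have a negative edge to [A]. By
   homogeneity they have no positive one, so [inX] is constant along positive edges, and its sum
   with the indicator of [A] along negative edges. *)
pose inX (B : {set arc}) := (B != A) && [exists c : crossing, exists B' : {set arc},
  [&& ~~ positive c, joins (G := G) c A B', B' != A & conn B' B]].
pose g : labelling := [ffun x => inX (cls os x)].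
pose h : labelling := [ffun x => (x \in A) (+) inX (cls os x)].
have inA x : (x \in A) = (cls os x == A).
  have [y ->] := glued_cls SA; rewrite mem_cls eq_sym eq_cls; done.
have edge_adj c B B' : joins (G := G) c B B' -> B != A -> B' != A -> inX B = inX B'.
  move=> cBB' BA B'A.
  have BB' : conn B B'.
    apply: connect1; apply: adjacent_remove => //; apply/existsP; exists c; by rewrite inE.
  rewrite /inX BA B'A; apply: eq_existsb => c'; apply: eq_existsb => B1; congr [&& _, _, _ & _].
  by apply: (same_connect_r _ BB'); apply: sym_connect_sym; apply: adjacent_sym.
have at_c c : joins (G := G) c (cls os (io c)) (cls os (iu c)).
  by rewrite /joins /= !eqxx.
have joinsC c B B' : joins (G := G) c B B' = joins (G := G) c B' B by rewrite /joins orbC.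
have far c B : joins (G := G) c A B -> B != A -> inX B = ~~ positive c.
  move=> cAB BA; rewrite /inX BA; apply/existsP/idP => [[c' /existsP[B' /and4P[nc' c'AB' B'A B'B]]]|nc].
    by rewrite -(homogeneous_sign ends_in hD c'AB' cAB B'A B'B : _ = positive c).
  by exists c; apply/existsP; exists B; rewrite nc cAB BA /conn connect0.
have inXA : inX A = false by rewrite /inX eqxx.
have os_cls x y : same os x y -> cls os x = cls os y by apply: cls_eq.
exists g, h; split.
- apply: respects_smooth_sign => [|c].
    by apply: same_respects => x y /os_cls; rewrite !ffunE => ->.
  rewrite eqbF_neg negbK => pc; rewrite !ffunE.
  have [E1|E1] := eqVneq (cls os (io c)) A; have [E2|E2] := eqVneq (cls os (iu c)) A.
  + by rewrite E1 E2.
  + by rewrite E1 inXA (far c _ _ E2) ?pc //; have := at_c c; rewrite E1.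
  + by rewrite E2 inXA (far c _ _ E1) ?pc // joinsC; have := at_c c; rewrite E2.
  + exact: edge_adj (at_c c) E1 E2.
- apply: respects_smooth_sign => [|c].
    by apply: same_respects => x y /os_cls; rewrite !ffunE !inA => ->.
  rewrite eqb_id => nc; rewrite !ffunE !inA.
  have [E1|E1] := eqVneq (cls os (io c)) A; have [E2|E2] := eqVneq (cls os (iu c)) A.
  + by rewrite E1 E2.
  + by rewrite E1 inXA (far c _ _ E2) ?nc //; have := at_c c; rewrite E1.
  + by rewrite E2 inXA (far c _ _ E1) ?nc // joinsC; have := at_c c; rewrite E2.
  + exact: edge_adj (at_c c) E1 E2.
- by move=> x; rewrite !ffunE addbC addbK.
Qed.

Lemma decomposable_respects f : respects os f -> decomposable f.
Proof.
have [n] := ubnP #|[set x | f x]|; elim: n f => // n IH f /ltnSE le_n osf.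
have addP b g g' : respects (smooth_sign b) g -> respects (smooth_sign b) g' ->
    respects (smooth_sign b) [ffun x => g x (+) g' x].
  move=> bg bg'; apply: same_respects => x y xy; rewrite !ffunE.
  by rewrite (respects_same bg xy) (respects_same bg' xy).
have [x fx|f0] := pickP f; last first.
  exists [ffun=> false], [ffun=> false]; split; try (by apply: same_respects => x y _; rewrite !ffunE).
  by move=> x; rewrite f0 !ffunE.
pose A := cls os x; pose f' : labelling := [ffun y => f y (+) (y \in A)].
have [||g [h [gP hP f'E]]] := IH f'.
- apply: leq_trans le_n; apply: proper_card; apply/properP; split.
    apply/subsetP => y; rewrite !inE ffunE mem_cls; have [xy|_] := boolP (same os x y).
      by rewrite -(respects_same osf xy) fx.
    by rewrite addbF.
  by exists x; rewrite ?inE // ffunE fx mem_cls connect0.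
- apply: same_respects => y z yz; rewrite !ffunE (respects_same osf yz) !mem_cls.
  by rewrite (same_connect_r (@same_sym _ _ _) yz).
have [g' [h' [g'P h'P AE]]] := decomposable_circle (cls_in os x).
exists [ffun y => g y (+) g' y], [ffun y => h y (+) h' y]; split; [exact: addP | exact: addP |].
move=> y; have := f'E y; have := AE y; rewrite !ffunE -/A.
by move: (f y) (y \in A) (g y) (g' y) (h y) (h' y) => [] [] [] [] [] [].
Qed.

(** Sending (g, h) to g + h and the value of g at [x0] is onto. The extra bit, which gives the
    strict inequality, comes from the constants, common to both spaces. *)
Lemma homogeneous_count (x0 : arc) :
  (nseifert D < #|glued (smooth_sign false)| + #|glued (smooth_sign true)|)%N.
Proof.
rewrite -(leq_exp2l (m := 2)) // expnS expnD -!card_respects mulnC.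
pose K b := [set f : labelling | respects (smooth_sign b) f].
pose F (p : labelling * labelling) : labelling * bool := ([ffun x => p.1 x (+) p.2 x], p.1 x0).
rewrite -[X in (X <= _)%N](_ : #|setX [set f : labelling | respects os f] [set: bool]| = _); last first.
  by rewrite cardsX cardsT card_bool.
rewrite -cardsX; apply: leq_trans (leq_imset_card F _); apply: subset_leq_card.
apply/subsetP => -[f b]; rewrite !inE andbT /= => /decomposable_respects[g [h [gP hP fE]]].
(* Adding [s] to both summands preserves their sum and moves the value at [x0] to [b]. *)
pose s := g x0 (+) b.
have shift b' g1 : respects (smooth_sign b') g1 ->
    respects (smooth_sign b') [ffun x => g1 x (+) s].
  by move=> g1P; apply: same_respects => x y xy; rewrite !ffunE (respects_same g1P xy).
apply/imsetP; exists ([ffun x => g x (+) s], [ffun x => h x (+) s]); first by rewrite !inE !shift.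
rewrite /F /= ffunE /s addbA addbb addFb; congr (_, _).
by apply/ffunP => x; rewrite !ffunE fE addbACA addbb addbF.
Qed.

(* cut_parity is chosen so that every component left after smoothing the
   positive crossings contains an odd number of circles labelled v_-. *)
Definition cut_parity (X : {set arc}) := ~~ odd #|within (circles So) X|.

Definition test_cochain := parity_chain lab (parity true cut_parity).

Lemma test_cochain_boundary u : pairing test_cochain (lee_d u) = 0.
Proof.
apply: pairing_lee_d => c nc P.
by apply: parity_toggle; rewrite ?(negPf nc) // crossing_circles.
Qed.

(** At least one v_- per component leaves at most O - O_- circles labelled v_+, and
    [homogeneous_count] bounds this by O_+ - 1. *)
Lemma test_cochain_degree v : test_cochain v != 0 ->
  qdeg v <= writhe D - (nseifert D)%:Z + 2 * (nplus D)%:Z - 2.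
Proof.
rewrite /test_cochain ffunE; case: (ones v =P So) => [vS|_] //=.
case: ifP => [tP _|_]; last by rewrite eqxx.
have sv := plus_sub v; rewrite vS in sv.
have tP' : parity true (fun=> true) (circles So :\: plus_circles v).
  apply/forall_inP => X gX; move/forall_inP/(_ X gX)/eqP: tP; rewrite /cut_parity => tX.
  rewrite eqb_id (_ : within _ X = within (circles So) X :\: within (plus_circles v) X); last first.
    by apply/setP => C; rewrite !inE; case: (C \subset X); rewrite ?andbT ?andbF.
  have sX : within (plus_circles v) X \subset within (circles So) X.
    by apply/subsetP => C; rewrite !inE => /andP[/(subsetP sv) -> ->].
  rewrite cardsD (setIidPr sX) oddB ?subset_leq_card // tX.
  by case: (odd _).
have := parity_card (subsetDl _ _) tP'; rewrite cardsD (setIidPr sv).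
have [x0 _] := exists_arc; have := homogeneous_count x0; rewrite -nplusE.
rewrite (_ : [set X in comps true | _] = comps true); last by apply/setP => X; rewrite inE andbT.
have := subset_leq_card sv; rewrite qdeg_oriented // circles_oriented -/(nseifert D).
lia.
Qed.

End Diagram.

(** * The Rasmussen invariant from the two bounds *)

Lemma exists_chain_q (D : diagram_data) (y : lee_chain D) : y != 0 -> exists j, chain_q y j.
Proof.
move=> y0; have [v0 yv0] : exists v, y v != 0.
  apply/existsP; apply: contraNT y0; rewrite negb_exists => /forallP h.
  by apply/eqP/ffunP => v; rewrite ffunE; apply/eqP/negbNE/h.
have [v yv vmin] := @arg_minP _ _ _ v0 (fun v => y v != 0) (@qdeg D) yv0.
by exists (qdeg v); split; [exists v | move=> k [w yw <-]; apply: vmin].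
Qed.

Theorem theorem1p2 (D : diagram_data) (hK : is_knot_diagram D)
    (hD : homogeneous D) :
  is_rasmussen D (writhe D - (nseifert D)%:Z + 2 * (nplus D)%:Z - 1).
Proof.
have [l [l_alt l_cross]] := checkerboard hK.
set m := writhe D - (nseifert D)%:Z + 2 * (nplus D)%:Z - 2.
exists m; first by rewrite /m; lia.
(* [phi] is an invariant of the homology class and vanishes on chains supported in degrees above
   [m]. *)
pose phi := pairing (test_cochain l).
have phi_homologous x y : homologous x y -> phi x = phi y.
  case=> z yxz; apply/eqP; rewrite eq_sym -subr_eq0 -(test_cochain_boundary hK l_alt l_cross z) -yxz.
  by rewrite /phi /pairing -sumrB; apply/eqP/eq_bigr => v _; rewrite !ffunE mulrBr.
have phi_deg y : phi y != 0 -> exists2 v, y v != 0 & qdeg v <= m.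
  move=> py; have [v] : exists v, test_cochain l v * y v != 0.
    apply/existsP; apply: contraNT py; rewrite negb_exists => /forallP h.
    by rewrite /phi /pairing big1 // => v _; apply/eqP/negbNE/h.
  rewrite mulf_eq0 negb_or => /andP[tv yv]; exists v => //.
  exact: test_cochain_degree tv.
split=> [|k [x [dx nx [_ kmax]]]].
  (* On the untruncated canonical cycle [phi] is the number of sets satisfying the parity condition,
     hence nonzero. Its class has a representative of filtration exactly [m], and none of higher
     filtration. *)
  pose x := parity_chain (lab l) xpredT : lee_chain D.
  have dx : lee_cycle x by apply: (lee_cycle_parity_chain l_alt l_cross).
  have phix : phi x != 0 by rewrite /phi pairing_parity_chain count_parity_neq0.
  have phi0 : phi 0 = 0 by rewrite /phi /pairing big1 // => v _; rewrite [X in _ * X]ffunE mulr0.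
  exists x; split=> //; first by move/phi_homologous; rewrite phi0 => /eqP; apply/negP.
  have [y xy ymin] := homologous_lower_bound hK l_alt l_cross dx.
  have phiy : phi y != 0 by rewrite -(phi_homologous x y).
  split.
    exists y => //; have [v yv vm] := phi_deg y phiy.
    split; last by move=> k [w yw <-]; apply: ymin.
    by exists v => //; apply/eqP; rewrite eq_le vm ymin.
  move=> k [y' xy' [_ kmin]].
  have [|v y'v vm] := phi_deg y'; first by rewrite -(phi_homologous x y').
  by apply: le_trans vm; apply: kmin; exists v.
(* For any nonzero class, the lower bound gives a representative of filtration at least [m], which
   the maximum dominates. *)
have [y xy ymin] := homologous_lower_bound hK l_alt l_cross dx.
have y0 : y != 0.
  by apply/eqP => y0; apply: nx; rewrite -y0.
have [j yj] := exists_chain_q y0.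
apply: le_trans (kmax j _); last by exists y.
by have [[v yv <-] _] := yj; apply: ymin.
Qed.
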